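(* Let $A,B\in\mathcal P(d)$ be such that $$\log\lambda(A^{-1}B)\neq\left(\log\lambda(B)-\log\lambda(A)\right)^{\downarrow}.$$ Then, for some sufficiently small $t_0>0$, there exists a continuous curve $\gamma:(-t_0,t_0)\to\mathcal U(d)$ such that $\gamma(0)=I$ and, for every $t\in(-t_0,t_0)$ with $t\neq 0$, $$\log\lambda\left(A^{-1}B\right)\neq\log\lambda\left(A^{-1}\gamma(t)B\gamma(t)^*\right)\quad\text{and}\quad \log\lambda\left(A^{-1}\gamma(t)B\gamma(t)^*\right)\prec\log\lambda\left(A^{-1}B\right).$$
   Context: $\mathcal P(d)$ is the set of (strictly) positive definite complex $d\times d$ matrices and $\mathcal U(d)$ is the group of unitary $d\times d$ matrices, with the topology of the spectral norm; $I$ is the identity matrix. For a matrix $C$ with real eigenvalues, $\lambda(C)=(\lambda_i(C))_{i=1}^d\in\mathbb R^d$ is the vector of its eigenvalues counted with (algebraic) multiplicity and arranged in non-increasing order; this applies to selfadjoint matrices and to products of two positive definite matrices, whose eigenvalues are positive real numbers. For a vector $x$ with positive entries, $\log x$ is taken entrywise. For $x\in\mathbb R^d$, $x^\downarrow$ is the vector obtained by rearranging the entries of $x$ in non-increasing order. For $x,y\in\mathbb R^d$, $x\prec y$ ($x$ is majorized by $y$) means $\sum_{i=1}^j x_i^\downarrow\le\sum_{i=1}^j y_i^\downarrow$ for every $1\le j\le d$ and $\sum_{i=1}^d x_i=\sum_{i=1}^d y_i$. *)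

(* Defs.v *)
From HB Require Import structures.
From mathcomp Require Import all_boot all_order all_algebra.
From mathcomp Require Import complex.
From mathcomp Require Import all_classical all_reals all_analysis.

Set Implicit Arguments.
Unset Strict Implicit.
Unset Printing Implicit Defensive.

Import Order.TTheory GRing.Theory Num.Theory.
Import numFieldNormedType.Exports.

Local Open Scope classical_set_scope.
Local Open Scope ring_scope.
Local Open Scope sesquilinear_scope.
Local Open Scope complex_scope.

Section Defs.
Context {R : realType} {d : nat}.
Implicit Types (C : 'M[R[i]]_d) (x y : 'rV[R]_d).

(* The order of R[i] is partial: 0 < z means that z is real and positive. *)
Definition posdefmx C : Prop :=
  C \is hermsymmx /\
  forall v : 'cV[R[i]]_d, v != 0 -> 0 < (v^t* *m C *m v) 0 0.

Definition dec_rearr x : 'rV[R]_d :=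
  \row_(i < d) (sort >=%R [seq x 0 j | j <- enum 'I_d])`_i.

Definition char_roots C : seq R[i] :=
  sval (closed_field_poly_normal (char_poly C)).

(* The eigenvalues are the roots of the characteristic polynomial, repeated
   according to their algebraic multiplicity; there are d of them since the
   polynomial is monic of degree d. Taking real parts loses nothing on the
   matrices with real spectrum, the only ones for which lambda(C) is meant. *)
Definition eigvals C : 'rV[R]_d :=
  \row_(i < d) (sort >=%R [seq complex.Re z | z <- char_roots C])`_i.

Definition logv x : 'rV[R]_d := map_mx (@ln R) x.

Definition majorized x y : Prop :=
  (forall j : nat, (1 <= j <= d)%N ->
     \sum_(i < d | (i < j)%N) dec_rearr x 0 i <=
     \sum_(i < d | (i < j)%N) dec_rearr y 0 i) /\
  \sum_(i < d) x 0 i = \sum_(i < d) y 0 i.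

Definition euclidean_norm (v : 'cV[R[i]]_d) : R :=
  Num.sqrt (\sum_(i < d) (complex.Re (v i 0) ^+ 2 + complex.Im (v i 0) ^+ 2)).

Definition spectral_norm C : R :=
  sup [set euclidean_norm (C *m v) | v in [set v | euclidean_norm v = 1]].

(* A curve (a, b) -> M_d(C) is a total function used only on (a, b); as (a, b)
   is open, its values elsewhere do not affect the limits at points of (a, b). *)
Definition continuous_curve (a b : R) (gamma : R -> 'M[R[i]]_d) : Prop :=
  forall s, a < s < b -> spectral_norm (gamma t - gamma s) @[t --> s] --> (0 : R).

End Defs.

(* Main.v *)
Require Import Defs.
From HB Require Import structures.
From mathcomp Require Import all_boot all_order all_algebra.
From mathcomp Require Import complex boolp reals sequences exp.
From mathcomp Require Import ring lra zify.

Set Implicit Arguments.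
Unset Strict Implicit.
Unset Printing Implicit Defensive.

Import Order.TTheory GRing.Theory Num.Theory.

Local Open Scope ring_scope.
Local Open Scope sesquilinear_scope.

(** Throughout, V^* denotes the adjoint of V. The pair (A, B) is diagonalized by
    a congruence, V^* A V = 1 and V^* B V = D = diag(mu), where mu lists the
    eigenvalues of A^-1 B. Replacing B by U B U^* with U unitary replaces D by
    V^* U B U^* V, and determinants show that the sum of the logarithms of the
    eigenvalues does not change. Put x = ln mu. Only curves of the form
    U(t) = cayley (|t| X), with X skew-Hermitian, are used: they are unitary,
    Lipschitz and equal to 1 at 0. So the claim becomes that a one-parameter
    family of rotations strictly decreases x in the majorization order for
    small t > 0, which is what [improvable] says.

    Let A and B not commute, and suppose first that only scalar matrices commute
    with both. To first order the rotation changes mu through the entries of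
    V^* (XA - AX) V at positions (i, k) with mu_i = mu_k. A matrix D' that
    commutes with D and is orthogonal to all the blocks so obtained gives a
    matrix V D' V^* A that commutes with A and with B, hence is a scalar; by
    duality every diagonal of trace zero is realized ([exists_generator]). The
    choice delta = mean(x) - x pushes ln mu straight towards its mean. The
    entries with mu_i <> mu_k are removed to first order by a second rotation,
    which does not affect the spectrum, so that the matrix is unitarily
    similar to diag(mu (1 + t delta)) + O(t^2)
    ([exists_isospectral_generators]).

    Its eigenvalues are therefore, up to O(t^2), averages of the numbers
    mu_k (1 + t delta_k) with doubly stochastic weights. Concavity of ln then
    bounds the sum of any j of the new logarithms below by
    (1 - t) s_j + t j mean(x) - O(t^2), where s_j is the sum of the j smallest
    entries of x. As x is not constant, s_j < j mean(x) for 0 < j < d, and the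
    bound exceeds s_j for small t: this is strict majorization
    ([strict_maj_near], [irreducible_improvable]). Bounding the smallest sums from
    below, rather than the largest from above, is what makes the concavity of
    ln act in the right direction.

    If a nonscalar matrix commutes with A and B, so does a nonscalar Hermitian
    one. Its eigenspaces split the pair into an orthogonal direct sum, one
    summand of which does not commute. Strict majorization survives the
    adjunction of common entries, so induction on the dimension applies
    ([noncommuting_improvable]).

    If A and B commute, they are diagonal with entries a and b in a common
    orthonormal basis. If a and b can be sorted simultaneously, then
    ln lambda(A^-1 B) is the decreasing rearrangement of
    ln lambda(B) - ln lambda(A), which the hypothesis excludes
    ([aligned_log_spectra]). Otherwise a_j < a_i and b_i < b_j for some i, j;
    a rotation of that coordinate plane keeps the product of the two
    eigenvalues and strictly decreases their sum ([crossing_improvable]). *)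

(** * Majorization of real sequences *)

Section Majorization.
Context {R : realType}.
Implicit Types (s u : seq R) (c : R).

(** Majorization is equivalent to the comparison of these sums for all c, when
    the totals agree. In this form it passes to concatenations at once. *)
Definition deficit c s : R := \sum_(x <- s) Num.max 0 (c - x).

Definition strict_maj s' s : Prop :=
  [/\ \sum_(x <- s') x = \sum_(x <- s) x,
      forall c, deficit c s' <= deficit c s &
      exists c, deficit c s' < deficit c s].

Lemma strict_maj_cat s' s u : strict_maj s' s -> strict_maj (s' ++ u) (s ++ u).
Proof.
case=> eq_sum le_def [c lt_def]; split.
- by rewrite !big_cat eq_sum.
- by move=> c'; rewrite /deficit !big_cat lerD2r le_def.
- by exists c; rewrite /deficit !big_cat ltrD2r.
Qed.

Lemma strict_maj_perm s1' s2' s1 s2 : perm_eq s1' s2' -> perm_eq s1 s2 ->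
  strict_maj s1' s1 -> strict_maj s2' s2.
Proof.
move=> p' p [eq_sum le_def [c lt_def]]; split.
- by rewrite -(perm_big _ p') -(perm_big _ p).
- by move=> c'; rewrite /deficit -(perm_big _ p') -(perm_big _ p); exact: le_def.
- by exists c; rewrite /deficit -(perm_big _ p') -(perm_big _ p).
Qed.

Lemma strict_maj_neq s' s : strict_maj s' s -> ~~ perm_eq s' s.
Proof.
case=> _ _ [c]; apply: contraTN => p.
by rewrite /deficit (perm_big _ p) ltxx.
Qed.

(** Since max(0, z) - max(0, -z) = z, comparing deficits below c is the same as
    comparing surpluses above c, once lengths and sums agree. *)
Lemma surplusE c s :
  \sum_(x <- s) Num.max 0 (x - c) = deficit c s + \sum_(x <- s) x - c *+ size s.
Proof.
rewrite /deficit; elim: s => [|x s IHs]; first by rewrite !big_nil mulr0n subr0 addr0.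
rewrite !big_cons IHs /= mulrS.
by case: (leP 0 (x - c)) => ?; case: (leP 0 (c - x)) => ?; lra.
Qed.

(** If c is the j-th largest entry of s, any j entries of s' sum to at most j c
    plus the surplus of s' above c; that surplus is at most the one of s, for
    which equality holds. *)
Lemma topsum_le s' s (j : nat) : strict_maj s' s -> size s' = size s ->
  (0 < j <= size s)%N ->
  \sum_(0 <= i < j) (sort >=%R s')`_i <= \sum_(0 <= i < j) (sort >=%R s)`_i.
Proof.
move=> smaj eq_sz /andP[j0 jn].
have ge_tot : total (>=%R : rel R) by move=> a b; exact: ge_total.
have ge_refl : reflexive (>=%R : rel R) by move=> a; exact: lexx.
have ge_trans : transitive (>=%R : rel R) by move=> a b c ba ac; exact: le_trans ac ba.
have {smaj}[] := strict_maj_perm (s2' := sort >=%R s') (s2 := sort >=%R s) _ _ smaj.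
- by rewrite perm_sym perm_sort.
- by rewrite perm_sym perm_sort.
set r' := sort _ s'; set r := sort _ s => eq_sum le_def _.
have szr' : size r' = size s by rewrite size_sort.
have szr : size r = size s by rewrite size_sort.
have r_sorted : sorted >=%R r by exact: sort_sorted.
(* The threshold is the j-th largest entry of s: the surplus of s above it is
   exactly that of its j largest entries. *)
pose c := r`_j.-1.
have top v : \sum_(0 <= i < j) v`_i = \sum_(0 <= i < j) (v`_i - c) + c *+ j.
  by rewrite sumrB sumr_const_nat subn0 addrNK.
have surplus_split v : size v = size s ->
    \sum_(x <- v) Num.max 0 (x - c) =
    \sum_(0 <= i < j) Num.max 0 (v`_i - c)
    + \sum_(j <= i < size s) Num.max 0 (v`_i - c).
  by move=> szv; rewrite (big_nth 0) szv (big_cat_nat (n := j)).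
rewrite !top lerD2r.
apply: (@le_trans _ _ (\sum_(x <- r') Num.max 0 (x - c))).
  rewrite surplus_split // -[leLHS]addr0 lerD //.
    by apply: ler_sum => i _; rewrite le_max lexx orbT.
  by apply: sumr_ge0 => i _; rewrite le_max lexx.
apply: (@le_trans _ _ (\sum_(x <- r) Num.max 0 (x - c))).
  by rewrite !surplusE szr szr' eq_sum !lerD2r le_def.
rewrite surplus_split // [X in _ + X]big_nat_cond [X in _ + X]big1 ?addr0.
  rewrite big_nat_cond [leRHS]big_nat_cond; apply: ler_sum => i.
  rewrite andbT => /andP[_ ij]; rewrite ge_max lexx andbT subr_ge0.
  apply: (sorted_leq_nth ge_trans ge_refl 0 r_sorted) => //; rewrite ?inE ?szr ?prednK //.
  - by rewrite (leq_trans ij jn).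
  - by rewrite -ltnS prednK.
move=> i; rewrite andbT => /andP[ji iN]; apply/max_idPl; rewrite subr_le0.
apply: (sorted_leq_nth ge_trans ge_refl 0 r_sorted) => //; rewrite ?inE ?szr ?prednK //.
by rewrite (leq_trans (leq_pred _)).
Qed.

Section Subsets.
Variable n : nat.
Implicit Types (x y w : 'I_n -> R) (I J : {set 'I_n}).

Lemma sum_codom (f : R -> R) x : \sum_(z <- codom x) f z = \sum_i f (x i).
Proof. by rewrite big_map big_enum. Qed.

(** The criterion by which majorization is established below: subset sums of y
    dominate subset sums of x of the same size. No sorting is involved. *)
Lemma strict_maj_subsets x y : (1 < n)%N -> \sum_i y i = \sum_i x i ->
  (forall I, (0 < #|I| < n)%N ->
     exists2 J : {set 'I_n}, #|J| = #|I| & \sum_(i in J) x i < \sum_(i in I) y i) ->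
  strict_maj (codom y) (codom x).
Proof.
move=> n1 eq_sum lt_sub; split.
- by rewrite !(sum_codom idfun).
- move=> c; rewrite /deficit !(sum_codom (fun z => Num.max 0 (c - z))).
  (* The deficit of y at c is the sum of c - y i over these i; the set J of
     the hypothesis then witnesses a larger deficit for x. *)
  pose I := [set i | y i < c].
  have defI : \sum_i Num.max 0 (c - y i) = \sum_(i in I) (c - y i).
    rewrite [RHS]big_mkcond; apply: eq_bigr => i _; rewrite inE.
    by case: (ltP (y i) c) => ?; [apply/max_idPr|apply/max_idPl]; lra.
  have sub_le J : \sum_(i in J) (c - x i) <= \sum_i Num.max 0 (c - x i).
    rewrite [leLHS]big_mkcond; apply: ler_sum => i _.
    by case: ifP => _; rewrite le_max lexx ?orbT.
  rewrite defI; have [I0|] := posnP #|I|.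
    rewrite (cards0_eq I0) big_set0; apply: sumr_ge0 => i _.
    by rewrite le_max lexx.
  have := subset_leq_card (subsetT I); rewrite cardsT card_ord leq_eqVlt.
  move=> /orP[/eqP In _|In I0].
    have -> : I = setT :> {set 'I_n}.
      by apply/eqP; rewrite eqEcard subsetT cardsT card_ord In leqnn.
    apply: le_trans (sub_le setT).
    rewrite !sumrB; rewrite lerD2l lerN2.
    by under eq_bigl do rewrite inE; under [leRHS]eq_bigl do rewrite inE; rewrite eq_sum.
  have [|J cJ ltJ] := lt_sub I; first by rewrite I0 In.
  apply: le_trans (sub_le J); rewrite !sumrB !sumr_const cJ lerD2l lerN2; exact: ltW.
- (* At the least entry of y the deficit of y vanishes, that of x does not. *)
  pose i0 := Ordinal (ltnW n1); pose k := [arg min_(i < i0) y i]%O.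
  have ymin i : y k <= y i by rewrite /k; case: arg_minP => // ? _; apply.
  have [|J] := lt_sub [set k]; first by rewrite cards1 n1.
  rewrite cards1 => /eqP/cards1P[l ->]; rewrite !big_set1 => lt_lk.
  exists (y k); rewrite /deficit !(sum_codom (fun z => Num.max 0 (y k - z))).
  rewrite big1; last by move=> i _; apply/max_idPl; rewrite subr_le0.
  rewrite (bigD1 l) //= ltr_wpDr //.
    by apply: sumr_ge0 => i _; rewrite le_max lexx.
  by rewrite lt_max subr_gt0 lt_lk orbT.
Qed.

Lemma exists_bottom_set x (j : nat) : (j <= n)%N -> exists2 J : {set 'I_n}, #|J| = j &
  exists c, (forall k, k \in J -> x k <= c) /\ (forall k, k \notin J -> c <= x k).
Proof.
elim: j => [|j IHj] jn.
  exists set0; first exact: cards0.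
  (* any lower bound of the x k *)
  exists (- \sum_k `|x k|); split=> [k|k _]; first by rewrite inE.
  rewrite (bigD1 k) //= opprD; have := ler_normr (x k) `|x k|.
  have : 0 <= \sum_(i < n | i != k) `|x i| by apply: sumr_ge0.
  by have := lerNnormlW (lexx `|x k|); lra.
have [J cJ [c [leJ geJ]]] := IHj (ltnW jn).
have [k0 k0J] : exists k, k \notin J.
  apply/existsP; rewrite -negb_forall; apply: contraTN jn => /forallP inJ.
  have -> : j = n by rewrite -cJ -[RHS]card_ord; apply: eq_card => k; rewrite inJ.
  by rewrite ltnn.
pose l := [arg min_(k < k0 | k \notin J) x k]%O.
have [lJ lmin] : l \notin J /\ forall k, k \notin J -> x l <= x k.
  by rewrite /l; case: arg_minP => // k ? ?; split.
exists (l |: J); first by rewrite cardsU1 lJ cJ.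
exists (x l); split=> k; rewrite !inE.
  by case/orP => [/eqP->//|/leJ] /le_trans; apply; exact: geJ.
by rewrite negb_or => /andP[_]; exact: lmin.
Qed.

(** Moving weight from the indices outside J to those inside J can only lower
    the sum, as the threshold c separates the two. *)
Lemma weighted_sum_ge x w J c :
  (forall k, k \in J -> x k <= c) -> (forall k, k \notin J -> c <= x k) ->
  (forall k, 0 <= w k <= 1) -> \sum_k w k = #|J|%:R ->
  \sum_(k in J) x k <= \sum_k w k * x k.
Proof.
move=> leJ geJ w01 sumw; rewrite -subr_ge0.
have -> : \sum_k w k * x k - \sum_(k in J) x k =
    \sum_k (w k - (k \in J)%:R) * (x k - c).
  have -> : \sum_(k in J) x k = \sum_k (k \in J)%:R * x k.
    by rewrite big_mkcond; apply: eq_bigr => k _; case: ifP; rewrite ?mul1r ?mul0r.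
  under [RHS]eq_bigr do rewrite mulrBr mulrBl.
  rewrite !sumrB -mulr_suml sumrB sumw.
  have -> : \sum_k (k \in J)%:R = #|J|%:R :> R.
    by rewrite -sum1_card natr_sum [RHS]big_mkcond; apply: eq_bigr => k _; case: ifP.
  by rewrite subrr mul0r subr0.
apply: sumr_ge0 => k _; have /andP[w0 w1] := w01 k; have [kJ|kJ] := boolP (k \in J).
  by apply: mulr_le0; rewrite subr_le0 // leJ.
by rewrite mulr_ge0 // ?subr0 ?subr_ge0 // geJ.
Qed.

(** n times the difference is a sum of nonnegative terms weighting x k - c for
    k outside J and c - x k for k in J; one of them is positive as x is not
    constant. *)
Lemma bottom_avg_lt x J c : (exists k l, x k < x l) ->
  (forall k, k \in J -> x k <= c) -> (forall k, k \notin J -> c <= x k) ->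
  (0 < #|J| < n)%N -> \sum_(k in J) x k < #|J|%:R * ((\sum_k x k) / n%:R).
Proof.
move=> [k [l ltkl]] leJ geJ /andP[J0 Jn].
have n0 : 0 < n%:R :> R by rewrite ltr0n (leq_trans _ Jn).
rewrite mulrA ltr_pdivlMr // -subr_gt0.
pose v i : R := if i \in J then (n%:R - #|J|%:R) * (c - x i)
                           else #|J|%:R * (x i - c).
have -> : #|J|%:R * \sum_k x k - (\sum_(k in J) x k) * n%:R = \sum_i v i.
  rewrite [RHS](bigID (mem J)) /= (bigID (mem J) predT) /=.
  rewrite [in RHS](eq_bigr (fun i => (n%:R - #|J|%:R) * (c - x i))); last first.
    by move=> i iJ; rewrite /v iJ.
  rewrite [X in _ = _ + X](eq_bigr (fun i => #|J|%:R * (x i - c))); last first.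
    by move=> i /negPf iJ; rewrite /v iJ.
  rewrite -!mulr_sumr !sumrB !sumr_const.
  have -> : #|[pred i | i \notin J]| = (n - #|J|)%N.
    have -> : #|[pred i | i \notin J]| = #|~: J| by apply: eq_card => i; rewrite !inE.
    by apply/eqP; rewrite -(eqn_add2l #|J|) cardsC card_ord subnKC // ltnW.
  rewrite -!(mulr_natl c) natrB ?(ltnW Jn) //.
  set a := \sum_(_ in _) _; set b := \sum_(_ | _) _; ring.
have v0 i : 0 <= v i.
  rewrite /v; case: ifPn => iJ; rewrite mulr_ge0 ?subr_ge0 ?ler_nat //.
  - exact: ltnW.
  - exact: leJ.
  - exact: geJ.
have vpos i : x i != c -> 0 < v i.
  move=> xic; rewrite lt_neqAle v0 andbT eq_sym /v; case: ifP => iJ.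
    by rewrite mulf_neq0 // subr_eq0 ?eqr_nat ?(gtn_eqF Jn) // eq_sym.
  by rewrite mulf_neq0 ?subr_eq0 // pnatr_eq0 -lt0n.
have [i vi] : exists i, 0 < v i.
  have [xkc|xkc] := eqVneq (x k) c; last by exists k; exact: vpos.
  by exists l; apply: vpos; rewrite -xkc gt_eqF.
by rewrite (bigD1 i) //= ltr_pwDl // sumr_ge0.
Qed.

(** Moving x towards its mean raises the sum of its j smallest entries at a
    positive speed, which for small t beats a quadratic error. The weights w
    stand for the partial column sums of a doubly stochastic matrix. *)
Lemma strict_maj_near x (C : R) : (exists k l, x k < x l) ->
  exists2 t0 : R, 0 < t0 & forall t y, 0 < t < t0 -> \sum_i y i = \sum_i x i ->
  (forall I, exists w : 'I_n -> R, [/\ forall k, 0 <= w k <= 1, \sum_k w k = #|I|%:R &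
     \sum_k w k * (x k + t * ((\sum_i x i) / n%:R - x k)) - C * t ^+ 2
       <= \sum_(i in I) y i]) ->
  strict_maj (codom y) (codom x).
Proof.
move=> ncst; set m := (_ / _).
have n1 : (1 < n)%N.
  case: ncst => k [l]; rewrite ltnNge; apply: contraTN => n1.
  have -> : k = l; last by rewrite ltxx.
  by apply: val_inj => /=; have := ltn_ord k; have := ltn_ord l; lia.
have bot (j : 'I_n) : exists J : {set 'I_n}, (#|J| = j /\
   exists c, (forall k, k \in J -> x k <= c) /\ (forall k, k \notin J -> c <= x k)).
  by have [J ? ?] := exists_bottom_set x (ltnW (ltn_ord j)); exists J.
have [J botJ] := boolp.choice bot.
pose g (j : 'I_n) := j%:R * m - \sum_(k in J j) x k.
have g0 (j : 'I_n) : (0 < j)%N -> 0 < g j.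
  move=> j0; have [cJ [c [leJ geJ]]] := botJ j; rewrite subr_gt0.
  have := bottom_avg_lt ncst leJ geJ; rewrite cJ; apply; by rewrite j0 ltn_ord.
pose C1 := `|C| + 1.
have C1_gt0 : 0 < C1 by rewrite ltr_wpDl.
pose t0 := \big[Num.min/1]_(j < n | (0 < j)%N) (g j / C1).
exists t0.
  rewrite /t0; elim/big_ind: _ => // [a b ? ?|j /g0 ?]; last by rewrite divr_gt0.
  by rewrite lt_min; apply/andP.
move=> t y /andP[t_gt0 tt0] eq_sum wI; apply: strict_maj_subsets => // I cI.
have /andP[I0 In] := cI; pose j := Ordinal In.
have [cJ [c [leJ geJ]]] := botJ j.
exists (J j) => //; have [w [w01 sumw]] := wI I; apply: lt_le_trans.
have t1 : t < 1 by apply: lt_le_trans tt0 _; rewrite /t0; apply: bigmin_le_id.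
have tg : t * C1 < g j.
  by rewrite -ltr_pdivlMr //; apply: lt_le_trans tt0 _; apply: bigmin_le_cond.
have -> : \sum_k w k * (x k + t * (m - x k)) =
    (1 - t) * \sum_k w k * x k + t * (#|I|%:R * m).
  rewrite -sumw mulr_suml !mulr_sumr -big_split /=; apply: eq_bigr => k _; ring.
have wx : \sum_(k in J j) x k <= \sum_k w k * x k.
  by apply: (weighted_sum_ge leJ geJ w01); rewrite sumw cJ.
have {}wx : (1 - t) * \sum_(k in J j) x k <= (1 - t) * \sum_k w k * x k.
  by rewrite ler_pM2l ?subr_gt0.
have CC : C * t ^+ 2 < t * g j.
  apply: (@le_lt_trans _ _ (t * (t * C1))); last by rewrite ltr_pM2l.
  rewrite mulrA -expr2 mulrC ler_wpM2l ?sqr_ge0 // /C1.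
  by have := ler_norm C; lra.
by move: wx CC; rewrite /g /=; set a := \sum_(_ in _) _; set b := \sum_k _; lra.
Qed.

End Subsets.
End Majorization.

(** * Adjoints, congruences and Cayley transforms *)

Section Adjoint.
Variable C : numClosedFieldType.

Lemma adjE m n (A : 'M[C]_(m, n)) i j : (A^t* ) i j = (A j i)^*.
Proof. by rewrite !mxE. Qed.

Lemma adjM m n p (A : 'M[C]_(m, n)) (B : 'M[C]_(n, p)) :
  (A *m B)^t* = B^t* *m A^t*.
Proof. by rewrite trmx_mul map_mxM. Qed.

Lemma adjD m n (A B : 'M[C]_(m, n)) : (A + B)^t* = A^t* + B^t*.
Proof. by rewrite linearD map_mxD. Qed.

Lemma adjN m n (A : 'M[C]_(m, n)) : (- A)^t* = - A^t*.
Proof. by rewrite linearN map_mxN. Qed.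

Lemma adj1 n : (1%:M : 'M[C]_n)^t* = 1%:M.
Proof. by rewrite trmx1 map_mx1. Qed.

Lemma adj_inv n (A : 'M[C]_n) : (invmx A)^t* = invmx (A^t*).
Proof. by rewrite trmx_inv map_invmx. Qed.

Lemma hermP n (A : 'M[C]_n) : reflect (A^t* = A) (A \is hermsymmx).
Proof.
by rewrite is_hermitianmxE expr0 scale1r eq_sym; apply: (iffP eqP).
Qed.

Lemma char_poly_sim m n (P : 'M[C]_(m, n)) (Q : 'M[C]_(n, m)) (A : 'M[C]_n) :
  P *m Q = 1%:M -> Q *m P = 1%:M -> char_poly (P *m A *m Q) = char_poly A.
Proof.
move=> PQ QP; have mn : m = n.
  apply/eqP; rewrite eqn_leq; apply/andP; split.
    have: (\rank (P *m Q) <= n)%N := leq_trans (mxrankM_maxl _ _) (rank_leq_col _).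
    by rewrite PQ mxrank1.
  have: (\rank (Q *m P) <= m)%N := leq_trans (mxrankM_maxl _ _) (rank_leq_col _).
  by rewrite QP mxrank1.
move: P Q PQ QP; rewrite {}mn => P Q PQ QP; rewrite /char_poly.
have -> : char_poly_mx (P *m A *m Q) =
    map_mx polyC P *m char_poly_mx A *m map_mx polyC Q.
  rewrite /char_poly_mx mulmxBr mulmxBl !map_mxM; congr (_ - _).
  by rewrite scalar_mxC -mulmxA -map_mxM PQ map_mx1 mulmx1.
rewrite !det_mulmx mulrC mulrA -det_mulmx -map_mxM QP map_mx1 det1; exact: mul1r.
Qed.

Definition cayley n (K : 'M[C]_n) : 'M[C]_n := invmx (1%:M - K) *m (1%:M + K).

Lemma adj_mul_eq0 m n (v : 'M[C]_(m, n)) : v *m v^t* = 0 -> v = 0.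
Proof.
move=> v0; apply/matrixP => i j; rewrite [RHS]mxE.
have /matrixP/(_ i i) := v0; rewrite !mxE => /eqP.
rewrite psumr_eq0 => [/allP/(_ j)|k _]; last by rewrite !mxE mul_conjC_ge0.
by rewrite mem_index_enum => /(_ isT); rewrite !mxE mul_conjC_eq0 => /eqP.
Qed.

(** If v K = v then v v^* = v K v^* is both Hermitian and skew-Hermitian, so it
    vanishes, and v with it. *)
Lemma skew_unit n (K : 'M[C]_n) : K^t* = - K -> 1%:M - K \in unitmx.
Proof.
move=> Ksk; rewrite -row_free_unit -kermx_eq0; set v := kermx _.
have vK : v *m K = v.
  by apply/esym/eqP; rewrite -subr_eq0 -{1}[v]mulmx1 -mulmxBr mulmx_ker.
apply/eqP/adj_mul_eq0.
have vKv : v *m v^t* = - (v *m v^t* ).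
  by rewrite -{2}vK adjM Ksk mulNmx mulmxN mulmxA vK.
have /eqP := vKv; rewrite -subr_eq0 opprK -mulr2n -scaler_nat scaler_eq0.
by rewrite pnatr_eq0 => /eqP.
Qed.

Lemma mul_cayley n (K : 'M[C]_n) : 1%:M - K \in unitmx ->
  (1%:M - K) *m cayley K = 1%:M + K.
Proof. by move=> Ku; rewrite /cayley mulKVmx. Qed.

Lemma cayley_uniq n (K U : 'M[C]_n) : 1%:M - K \in unitmx ->
  (1%:M - K) *m U = 1%:M + K -> U = cayley K.
Proof. by move=> Ku UE; rewrite /cayley -UE mulKmx. Qed.

Lemma addsub_comm n (K : 'M[C]_n) :
  (1%:M + K) *m (1%:M - K) = (1%:M - K) *m (1%:M + K).
Proof.
rewrite mulmxDl mulmxBl !mul1mx mulmxBr mulmxDr !mulmx1.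
by rewrite opprD !addrA subrK addrK.
Qed.

Lemma cayley0 n : cayley (0 : 'M[C]_n) = 1%:M.
Proof. by rewrite /cayley subr0 addr0 mulVmx // unitmx1. Qed.

Lemma cayley_unitary n (K : 'M[C]_n) : K^t* = - K ->
  cayley K *m (cayley K)^t* = 1%:M /\ (cayley K)^t* *m cayley K = 1%:M.
Proof.
move=> Ksk; have Ku := skew_unit Ksk.
have Ku' : 1%:M + K \in unitmx.
  by rewrite -[K]opprK; apply: skew_unit; rewrite adjN Ksk opprK.
suff UU : cayley K *m (cayley K)^t* = 1%:M by split; [exact: UU | exact: mulmx1C].
rewrite /cayley adjM adj_inv !adjD adjN !adj1 Ksk opprK -mulmxA.
have -> : (1%:M + K) *m ((1%:M - K) *m invmx (1%:M + K)) =
    (1%:M - K) *m ((1%:M + K) *m invmx (1%:M + K)).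
  by rewrite mulmxA addsub_comm -mulmxA.
by rewrite mulmxV // mulmx1 mulVmx // skew_unit.
Qed.

Lemma invmx_cayley n (K : 'M[C]_n) : 1%:M - K \in unitmx ->
  1%:M + cayley K = 2 *: invmx (1%:M - K).
Proof.
move=> Ku; rewrite -[LHS](mulKmx Ku) mulmxDr mul_cayley // mulmx1.
by rewrite addrACA addNr addr0 -mulr2n -scaler_nat -scalemxAr mulmx1.
Qed.

(** Exact remainder of the first-order expansion of the transform at 0; it is
    quadratic because cayley K is bounded. *)
Lemma cayley_expansion n (K : 'M[C]_n) : 1%:M - K \in unitmx ->
  cayley K - 1%:M - 2 *: K = (1%:M + cayley K) *m (K *m K).
Proof.
move=> Ku; apply: (can_inj (mulKmx Ku)).
rewrite invmx_cayley // -scalemxAl -scalemxAr mulKVmx //.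
rewrite !mulmxBr mul_cayley // mulmx1 -scalemxAr mulmxBl mul1mx.
rewrite !scaler_nat !mulr2n; set KK := K *m K.
by rewrite !opprD !opprK; apply/matrixP => i j; rewrite !mxE; ring.
Qed.

(** A resolvent identity, from 1 + cayley K = 2 (1 - K)^-1. With cayley K and
    cayley L unitary it is a Lipschitz bound. *)
Lemma cayley_diff n (K L : 'M[C]_n) :
  1%:M - K \in unitmx -> 1%:M - L \in unitmx ->
  2 *: (cayley K - cayley L) =
  (1%:M + cayley K) *m (K - L) *m (1%:M + cayley L).
Proof.
move=> Ku Lu; apply: (can_inj (mulKmx Ku)); rewrite invmx_cayley //.
rewrite -!scalemxAl -!scalemxAr -!mulmxA mulKVmx //; congr (_ *: _).
rewrite mulmxBr mul_cayley //; apply: (can_inj (mulmxK Lu)).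
rewrite invmx_cayley // -!scalemxAr.
have cL : cayley L *m (1%:M - L) = 1%:M + L.
  by rewrite /cayley -mulmxA addsub_comm mulKmx.
rewrite mulmxBl -[_ *m cayley L *m _]mulmxA cL -scalemxAl -mulmxA mulVmx // mulmx1.
rewrite !(mulmxDl, mulmxDr, mulmxN, mulNmx, mulmx1, mul1mx) scaler_nat mulr2n.
by apply/matrixP => i j; rewrite !mxE; ring.
Qed.

Lemma adj_conj m n (W : 'M[C]_(m, n)) (M : 'M[C]_n) :
  (W *m M *m W^t* )^t* = W *m M^t* *m W^t*.
Proof. by rewrite !adjM trmxCK mulmxA. Qed.

Lemma adj_congr m n (V : 'M[C]_(n, m)) (M : 'M[C]_n) :
  (V^t* *m M *m V)^t* = V^t* *m M^t* *m V.
Proof. by rewrite !adjM trmxCK mulmxA. Qed.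

Lemma congr_mul_adj n (V W : 'M[C]_n) (M : 'M[C]_n) :
  (V *m W^t* )^t* *m M *m (V *m W^t* ) = W *m (V^t* *m M *m V) *m W^t*.
Proof. by rewrite adjM trmxCK !mulmxA. Qed.

Lemma congr_mul_adj2 n (V w P M : 'M[C]_n) :
  (V *m w^t* *m P^t* )^t* *m M *m (V *m w^t* *m P^t* ) =
  P *m (w *m (V^t* *m M *m V) *m w^t* ) *m P^t*.
Proof. by rewrite !congr_mul_adj. Qed.

Lemma mul_first_order n (t : C) (F F0 F1 G G0 G1 : 'M[C]_n) :
  F *m G - (F0 *m G0 + t *: (F0 *m G1 + F1 *m G0)) =
  t ^+ 2 *: (F1 *m G1) + (F0 + t *: F1) *m (G - (G0 + t *: G1))
  + (F - (F0 + t *: F1)) *m G.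
Proof.
rewrite !(mulmxBl, mulmxBr, mulmxDl, mulmxDr).
rewrite -?(scalemxAl, scalemxAr) !scalerDr !scalerA expr2.
by apply/matrixP => i j; rewrite !mxE; ring.
Qed.

Lemma det_unitary_conj n (U M : 'M[C]_n) : U *m U^t* = 1%:M ->
  \det (U *m M *m U^t* ) = \det M.
Proof. by move=> UU; rewrite !det_mulmx mulrAC -det_mulmx UU det1 mul1r. Qed.

Lemma det_congr n (V M N : 'M[C]_n) : \det M = \det N ->
  \det (V^t* *m M *m V) = \det (V^t* *m N *m V).
Proof. by move=> MN; rewrite !det_mulmx MN. Qed.

Lemma rotate_first_order n (X F0 F1 : 'M[C]_n) :
  F0 *m (2 *: - X) + (F1 + (2 *: X) *m F0) = F1 + 2 *: (X *m F0 - F0 *m X).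
Proof.
rewrite -scalemxAr -scalemxAl mulmxN scalerBr addrCA; congr (_ + _).
by rewrite addrC scalerN.
Qed.

End Adjoint.

(** * First-order generators of a rotated pencil *)

Section Generators.
Variable C : numClosedFieldType.

Lemma trace_mul_eq0 n (M : 'M[C]_n) : (forall X : 'M[C]_n, \tr (X *m M) = 0) -> M = 0.
Proof.
move=> trM; apply/matrixP => i j; have := trM (delta_mx j i).
rewrite /mxtrace (bigD1 j) //= big1 ?addr0 => [|k kj].
  rewrite mxE (bigD1 i) //= big1 ?addr0 => [|l li].
    by rewrite !mxE !eqxx mul1r.
  by rewrite !mxE (negPf li) andbF mul0r.
by rewrite mxE big1 // => l _; rewrite !mxE (negPf kj) mul0r.
Qed.

Section Pencil.
Variables (n : nat) (A B V : 'M[C]_n) (mu : 'I_n -> C).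
Let D : 'M[C]_n := diag_mx (\row_i mu i).
Hypotheses (VA : V^t* *m A *m V = 1%:M) (VB : V^t* *m B *m V = D).
Hypothesis irr : forall Y : 'M[C]_n, Y *m A = A *m Y -> Y *m B = B *m Y ->
  exists c, Y = c%:M.

Let VVA : V *m (V^t* *m A) = 1%:M.
Proof. exact: mulmx1C. Qed.

Let AVV : A *m V *m V^t* = 1%:M.
Proof. by apply: mulmx1C; rewrite mulmxA. Qed.

Lemma pencil_right : B = A *m V *m D *m (V^t* *m A).
Proof. by rewrite -VB !mulmxA AVV mul1mx -!mulmxA VVA mulmx1. Qed.

(** The matrix V D' V^* A = V D' V^-1 commutes with A by the second hypothesis,
    and with A^-1 B = V D V^-1 by the first; so it commutes with B. *)
Lemma pencil_centralizer_scalar (D' : 'M[C]_n) : D *m D' = D' *m D ->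
  A *m V *m D' *m V^t* = V *m D' *m V^t* *m A -> exists c, D' = c%:M.
Proof.
move=> DD' comA; have [||c Yc] := irr (Y := V *m D' *m V^t* *m A).
- by rewrite !mulmxA comA.
- have cancel N : V^t* *m (A *m (V *m N)) = N by rewrite !mulmxA VA mul1mx.
  rewrite pencil_right -[in LHS]comA -!mulmxA !cancel.
  by congr (_ *m (_ *m _)); rewrite !mulmxA DD'.
exists c; have : V^t* *m A *m (V *m D' *m V^t* *m A) *m V = c%:M.
  by rewrite Yc mul_mx_scalar -scalemxAl VA scalemx1.
have PV (M : 'M[C]_n) : M *m V^t* *m A *m V = M.
  by rewrite -!mulmxA (mulmxA _ A) VA mulmx1.
by rewrite !mulmxA VA mul1mx PV.
Qed.

(** Duality. The values at the positions with mu i = mu k form the image of a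
    linear map in X. On matrices supported at these positions, a linear form
    that vanishes on the image is Z |-> tr (Z D') with D' as in
    [pencil_centralizer_scalar]; so it is a multiple of the trace and vanishes
    on every diagonal matrix of trace zero. *)
Lemma exists_generator (delta : 'I_n -> C) : \sum_i delta i = 0 ->
  exists X : 'M[C]_n, forall i k, mu i = mu k ->
    (V^t* *m (X *m A - A *m X) *m V) i k = delta i *+ (i == k).
Proof.
move=> delta0.
pose f (X : 'M[C]_n) : 'M[C]_n := \matrix_(i, k)
  if mu i == mu k then (V^t* *m (X *m A - A *m X) *m V) i k else 0.
have commL a (X Y : 'M[C]_n) : V^t* *m ((a *: X + Y) *m A - A *m (a *: X + Y)) *m V =
    a *: (V^t* *m (X *m A - A *m X) *m V) + V^t* *m (Y *m A - A *m Y) *m V.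
  rewrite [(_ + _) *m A]mulmxDl [A *m (_ + _)]mulmxDr opprD addrACA.
  rewrite -scalemxAl -scalemxAr -scalerBr [in LHS]mulmxDr [in LHS]mulmxDl.
  by rewrite -[in LHS]scalemxAr -[in LHS]scalemxAl.
have flin : linear f.
  move=> a X Y; apply/matrixP => i k; rewrite mxE commL !mxE.
  by case: ifP; rewrite ?mulr0 ?addr0.
pose fL : {linear 'M[C]_n -> 'M[C]_n} :=
  HB.pack f (GRing.isLinear.Build _ _ _ _ f flin).
pose T : 'M[C]_n := diag_mx (\row_i delta i).
suff /submxP[w wT] : (mxvec T <= lin_mx fL)%MS.
  exists (vec_mx w) => i k eq_mu.
  have /(congr1 vec_mx) : mxvec T = mxvec (fL (vec_mx w)).
    by rewrite -(mul_vec_lin fL) vec_mxK.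
  by rewrite !mxvecK => /matrixP/(_ i k); rewrite /T /= /f !mxE eq_mu eqxx => <-.
rewrite submxE; apply/eqP/matrixP => i0 j; rewrite ord1 [RHS]mxE.
(* G is a linear form that vanishes on the image of f; it must vanish at T. *)
pose G : 'M[C]_n := vec_mx (col j (cokermx (lin_mx fL)))^T.
have dotG Z : (mxvec Z *m cokermx (lin_mx fL)) 0 j = \sum_i \sum_k Z i k * G i k.
  rewrite mxE (reindex _ (curry_mxvec_bij _ _)) /= pair_bigA /=.
  by apply: eq_bigr => -[i k] _ /=; rewrite mxvecE !mxE.
have fG X : \sum_i \sum_k f X i k * G i k = 0.
  by rewrite -dotG -[f X]/(fL X) -(mul_vec_lin fL) -mulmxA mulmx_coker mulmx0 mxE.
(* Transposing G turns the form into a trace; restricting it to the pairs with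
   equal mu makes it commute with D. *)
pose D' : 'M[C]_n := \matrix_(k, i) if mu i == mu k then G i k else 0.
have trD' X : \tr ((V^t* *m (X *m A - A *m X) *m V) *m D') = 0.
  rewrite -[RHS](fG X) /mxtrace; apply: eq_bigr => i _; rewrite mxE.
  apply: eq_bigr => k _; rewrite [D' _ _]mxE [f X _ _]mxE.
  by case: ifP => _; rewrite ?mulr0 ?mul0r.
have DD' : D *m D' = D' *m D.
  apply/matrixP => k i; rewrite mul_diag_mx mul_mx_diag !mxE.
  by case: eqP => [->|_]; rewrite ?mulr0 ?mul0r // mulrC.
have [|c D'c] := pencil_centralizer_scalar DD'.
  apply/eqP; rewrite -subr_eq0; apply/eqP/trace_mul_eq0 => X.
  rewrite -[RHS](trD' X) mulmxBr !(mulmxBl, mulmxBr) !raddfB /= !mulmxA.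
  congr (_ - _).
    by rewrite -!mulmxA [RHS]mxtrace_mulC -!mulmxA.
  by rewrite -!mulmxA [RHS]mxtrace_mulC -!mulmxA [RHS]mxtrace_mulC -!mulmxA.
rewrite dotG.
transitivity (\sum_i delta i * c); last by rewrite -mulr_suml delta0 mul0r.
apply: eq_bigr => i _; rewrite (bigD1 i) //= big1 ?addr0 => [|k ki].
  have /matrixP/(_ i i) := D'c; rewrite !mxE !eqxx => ->.
  by rewrite mulr1n.
by rewrite !mxE eq_sym (negPf ki) mul0r.
Qed.

(** Replacing X by - X^* replaces V^* (XA - AX) V by its adjoint, so the average
    of both still realizes a real diagonal. *)
Lemma exists_skew_generator (delta : 'I_n -> C) : A^t* = A -> \sum_i delta i = 0 ->
  (forall i, (delta i)^* = delta i) ->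
  exists2 X : 'M[C]_n, X^t* = - X & forall i k, mu i = mu k ->
    (V^t* *m (X *m A - A *m X) *m V) i k = delta i *+ (i == k).
Proof.
move=> Ah delta0 deltar; have [X XE] := exists_generator delta0.
have adjZ (c : C) (M : 'M[C]_n) : (c *: M)^t* = c^* *: M^t*.
  by apply/matrixP => i j; rewrite !mxE rmorphM.
exists (2^-1 *: (X - X^t* )).
  by rewrite adjZ adjD adjN trmxCK fmorphV /= rmorph_nat -scalerN opprB.
move=> i k eq_mu.
set Z := V^t* *m (X *m A - A *m X) *m V in XE.
have -> : V^t* *m (2^-1 *: (X - X^t* ) *m A - A *m (2^-1 *: (X - X^t* ))) *m V =
    2^-1 *: (Z + Z^t* ).
  have -> : Z^t* = V^t* *m (A *m X^t* - X^t* *m A) *m V.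
    by rewrite /Z !adjM trmxCK adjD adjN !adjM Ah mulmxA.
  rewrite /Z -mulmxDl -mulmxDr -scalemxAl -scalemxAr -scalerBr -scalemxAr -scalemxAl.
  congr (_ *: (_ *m _ *m _)); rewrite mulmxBl mulmxBr opprB !addrA.
  rewrite -!addrA; congr (_ + _); rewrite addrC !addrA.
  by apply/matrixP => a b; rewrite !mxE; ring.
rewrite mxE [X in _ * X]mxE adjE XE // XE // [k == i]eq_sym rmorphMn /= deltar.
case: eqVneq => [->|_]; last by rewrite !mulr0n addr0 mulr0.
by rewrite !mulr1n; field.
Qed.

(** The left-hand side is the first-order term of the conjugate of V^* U B U^* V
    by W, for U and W the Cayley transforms of t X and t Z. The generator Z
    solves the off-diagonal equations, dividing by mu i - mu k where mu i and
    mu k differ; [exists_skew_generator] handles the other positions. *)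
Lemma exists_isospectral_generators (delta : 'I_n -> C) :
  A^t* = A -> B^t* = B -> \sum_i delta i = 0 ->
  (forall i, (delta i)^* = delta i) -> (forall i, (mu i)^* = mu i) ->
  exists X Z : 'M[C]_n, [/\ X^t* = - X, Z^t* = - Z &
    2 *: (V^t* *m (X *m B - B *m X) *m V) + 2 *: (Z *m D - D *m Z) =
    diag_mx (\row_i (mu i * delta i))].
Proof.
move=> Ah Bh delta0 deltar mur.
have [||X Xsk XE] := exists_skew_generator (delta := fun i => delta i / 2) Ah.
- by rewrite -mulr_suml delta0 mul0r.
- by move=> i; rewrite rmorphM fmorphV rmorph_nat /= deltar.
pose Q := V^t* *m (X *m B - B *m X) *m V.
have Qh : Q^t* = Q.
  rewrite /Q !adjM trmxCK adjD adjN !adjM Bh Xsk mulmxA; congr (_ *m _ *m _).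
  by rewrite mulmxN mulNmx opprK addrC.
have QE i k : Q i k =
    (V^t* *m X *m A *m V) i k * mu k - mu i * (V^t* *m A *m X *m V) i k.
  have -> : Q = (V^t* *m X *m A *m V) *m D - D *m (V^t* *m A *m X *m V).
    rewrite /Q mulmxBr mulmxBl; congr (_ - _).
      by rewrite pencil_right !mulmxA -[RHS]mulmx1 -VA !mulmxA.
    by rewrite {1}pencil_right !mulmxA VA mul1mx.
  by rewrite mxE mul_mx_diag [in X in _ + X]mxE mul_diag_mx !mxE.
pose L := V^t* *m X *m A *m V; pose M := V^t* *m A *m X *m V.
have {}QE i k : Q i k = L i k * mu k - mu i * M i k by exact: QE.
have XLM i k : mu i = mu k -> L i k - M i k = delta i / 2 *+ (i == k).
  by move=> /XE <-; rewrite mulmxBr mulmxBl !mulmxA [RHS]mxE [X in _ = _ + X]mxE.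
(* When mu i = mu k the quotient by 0 is 0, as wanted. *)
pose Z : 'M[C]_n := \matrix_(i, k) (Q i k / (mu i - mu k)).
have ZE i k : Z i k = Q i k / (mu i - mu k) by rewrite mxE.
exists X, Z; split=> //.
  apply/matrixP => i k; rewrite adjE ZE [RHS]mxE ZE.
  rewrite rmorphM fmorphV rmorphB /= !mur.
  have -> : (Q k i)^* = Q i k by rewrite -{2}Qh adjE.
  by rewrite -mulrN -invrN opprB.
apply/matrixP => i k; rewrite -/Q -scalerDr.
have -> : (2 *: (Q + (Z *m D - D *m Z))) i k =
    2 * (Q i k + (Z i k * mu k - mu i * Z i k)).
  have -> : Z i k * mu k = (Z *m D) i k.
    by rewrite mul_mx_diag [RHS]mxE; congr (_ * _); rewrite mxE.
  have -> : mu i * Z i k = (D *m Z) i k.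
    by rewrite mul_diag_mx [RHS]mxE; congr (_ * _); rewrite mxE.
  rewrite [LHS]mxE; congr (_ * _); rewrite [LHS]mxE; congr (_ + _).
  by rewrite [LHS]mxE; congr (_ + _); rewrite [LHS]mxE.
rewrite !ZE [RHS]mxE [in RHS]mxE.
have [eq_mu|neq_mu] := eqVneq (mu i) (mu k).
  rewrite eq_mu subrr invr0 mulr0 mul0r mulr0 subrr addr0 QE eq_mu.
  rewrite [L i k * _]mulrC -mulrBr XLM //; case: eqVneq => [->|_]; last by rewrite !mulr0n !mulr0.
  by rewrite !mulr1n; field.
have -> : (i == k) = false by apply: contraNF neq_mu => /eqP->.
by rewrite mulr0n; field; rewrite subr_eq0.
Qed.
End Pencil.
End Generators.

(** * Splitting a pair of matrices, commuting Hermitian matrices *)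

Section Reduction.
Variable C : numClosedFieldType.

Lemma cayley_conj n (W K : 'M[C]_n) : W *m W^t* = 1%:M -> K^t* = - K ->
  cayley (W^t* *m K *m W) = W^t* *m cayley K *m W.
Proof.
move=> WW Ksk; have sW : W^t* *m W = 1%:M by exact: mulmx1C.
have K'sk : (W^t* *m K *m W)^t* = - (W^t* *m K *m W).
  by rewrite adj_congr Ksk mulmxN mulNmx.
apply/esym/cayley_uniq; first exact: skew_unit.
have cong M : 1%:M + W^t* *m M *m W = W^t* *m (1%:M + M) *m W.
  by rewrite mulmxDr mulmxDl mulmx1 sW.
have -> : 1%:M - W^t* *m K *m W = W^t* *m (1%:M - K) *m W.
  by rewrite -cong mulmxN mulNmx.
rewrite cong -(mul_cayley (skew_unit Ksk)).
by rewrite -!mulmxA (mulmxA W) WW mul1mx.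
Qed.

Lemma invmx_unitary_conj n (W A : 'M[C]_n) : W *m W^t* = 1%:M ->
  A \in unitmx -> invmx (W *m A *m W^t* ) = W *m invmx A *m W^t*.
Proof.
move=> WW Au; have sW : W^t* *m W = 1%:M by exact: mulmx1C.
have E : (W *m A *m W^t* ) *m (W *m invmx A *m W^t* ) = 1%:M.
  rewrite -!mulmxA (mulmxA (W^t* )) sW mul1mx (mulmxA A) mulmxV // mul1mx.
  exact: WW.
have [Wu _] := mulmx1_unit E.
by rewrite -[LHS]mulmx1 -E mulKmx.
Qed.

Lemma mul_conj m n (W : 'M[C]_(m, n)) (M N : 'M[C]_n) : W^t* *m W = 1%:M ->
  (W *m M *m W^t* ) *m (W *m N *m W^t* ) = W *m (M *m N) *m W^t*.
Proof. by move=> sW; rewrite -!mulmxA (mulmxA (W^t* ) W) sW mul1mx. Qed.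

Lemma conj_inj m n (W : 'M[C]_(m, n)) (M N : 'M[C]_n) : W^t* *m W = 1%:M ->
  W *m M *m W^t* = W *m N *m W^t* -> M = N.
Proof.
move=> sW /(congr1 (fun Z => W^t* *m Z *m W)); rewrite -!mulmxA sW !mulmx1.
by rewrite !mulmxA sW !mul1mx.
Qed.

Lemma invmx_mul_conj n (W A B : 'M[C]_n) : W *m W^t* = 1%:M -> A \in unitmx ->
  invmx (W *m A *m W^t* ) *m (W *m B *m W^t* ) = W *m (invmx A *m B) *m W^t*.
Proof.
move=> WW Au; have sW : W^t* *m W = 1%:M by exact: mulmx1C.
by rewrite invmx_unitary_conj // -!mulmxA (mulmxA (W^t* ) W) sW mul1mx.
Qed.

Lemma rotate_conj n (W U B : 'M[C]_n) : W *m W^t* = 1%:M ->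
  U *m (W *m B *m W^t* ) *m U^t* =
  W *m ((W^t* *m U *m W) *m B *m (W^t* *m U *m W)^t* ) *m W^t*.
Proof.
move=> WW; rewrite adj_congr -!mulmxA (mulmxA W (W^t* )) WW.
by rewrite mul1mx mulmx1.
Qed.

Lemma skew_block m k (K : 'M[C]_m) : K^t* = - K ->
  (block_mx K 0 0 (0 : 'M_k))^t* = - block_mx K 0 0 (0 : 'M_k).
Proof.
move=> Ksk; rewrite tr_block_mx map_block_mx /= Ksk !trmx0 !map_mx0.
by rewrite opp_block_mx !oppr0.
Qed.

Lemma cayley_block m k (K : 'M[C]_m) : K^t* = - K ->
  cayley (block_mx K 0 0 (0 : 'M_k)) = block_mx (cayley K) 0 0 1%:M.
Proof.
move=> Ksk; apply/esym/cayley_uniq.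
  exact/skew_unit/skew_block.
rewrite scalar_mx_block opp_block_mx !add_block_mx mulmx_block.
rewrite !(oppr0, addr0, add0r, mul0mx, mulmx0, mulmx1, mul1mx).
by rewrite mul_cayley // skew_unit.
Qed.

Lemma rotate_block m k (U B1 : 'M[C]_m) (B2 : 'M[C]_k) :
  block_mx U 0 0 1%:M *m block_mx B1 0 0 B2 *m (block_mx U 0 0 1%:M)^t* =
  block_mx (U *m B1 *m U^t* ) 0 0 B2.
Proof.
rewrite tr_block_mx map_block_mx /= !trmx0 !map_mx0 adj1 !mulmx_block.
by rewrite !(mul0mx, mulmx0, addr0, add0r, mul1mx, mulmx1).
Qed.

Lemma invmx_mul_block m k (A1 B1 : 'M[C]_m) (A2 B2 : 'M[C]_k) :
  A1 \in unitmx -> A2 \in unitmx ->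
  invmx (block_mx A1 0 0 A2) *m block_mx B1 0 0 B2 =
  block_mx (invmx A1 *m B1) 0 0 (invmx A2 *m B2).
Proof.
move=> A1u A2u; rewrite invmx_block_diag ?block_diag_mx_unit ?A1u // mulmx_block.
by rewrite !(mul0mx, mulmx0, addr0, add0r).
Qed.

Section Select.
Variables (p n : nat) (h : 'I_p -> 'I_n).
Let W : 'M[C]_(p, n) := rowsub h 1%:M.

Lemma select_conj (M : 'M[C]_n) : W *m M *m W^t* = mxsub h h M.
Proof.
have -> : W^t* = colsub h 1%:M.
  by apply/matrixP => i j; rewrite !mxE conjC_nat eq_sym.
by rewrite mul_rowsub_mx mul1mx mulmx_colsub mulmx1; apply/matrixP => i j; rewrite !mxE.
Qed.

Lemma select_isometry : injective h -> W *m W^t* = 1%:M.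
Proof.
move=> hinj; rewrite -{1}[W]mulmx1 select_conj.
by apply/matrixP => i j; rewrite !mxE (inj_eq hinj).
Qed.

Lemma select_unitary : bijective h -> W^t* *m W = 1%:M.
Proof.
case=> g hg gh; apply/matrixP => i j; rewrite mxE (bigD1 (g i)) //= big1.
  by rewrite !mxE gh eqxx conjC_nat mul1r addr0.
move=> k kgi; rewrite !mxE conjC_nat.
have -> : (h k == i) = false; last by rewrite mul0r.
by apply: contraNF kgi => /eqP<-; rewrite hg.
Qed.

End Select.

(** An enumeration of all indices that lists S first: it turns a matrix in which
    S and its complement do not interact into a block diagonal one. *)
Definition set_split n (S : {set 'I_n}) (i : 'I_(#|S| + #|~: S|)) : 'I_n :=
  match split i with inl a => enum_val a | inr b => enum_val b end.

Lemma set_split_bij n (S : {set 'I_n}) : bijective (@set_split n S).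
Proof.
apply: inj_card_bij; last by rewrite !card_ord cardsC card_ord.
move=> i j; rewrite /set_split -{2}(splitK i) -{2}(splitK j).
case: (split i) => a; case: (split j) => b /= e.
- by rewrite (enum_val_inj e).
- by have := enum_valP b; rewrite inE -e (enum_valP a).
- by have := enum_valP a; rewrite inE e (enum_valP b).
- by rewrite (enum_val_inj e).
Qed.

Definition decoupled n (S : {set 'I_n}) (M : 'M[C]_n) :=
  forall i j, (i \in S) != (j \in S) -> M i j = 0.

Definition restr n (S : {set 'I_n}) (M : 'M[C]_n) : 'M[C]_#|S| :=
  mxsub enum_val enum_val M.

Lemma decoupled_block n (S : {set 'I_n}) (M : 'M[C]_n) : decoupled S M ->
  mxsub (@set_split n S) (@set_split n S) M =
  block_mx (restr S M) 0 0 (restr (~: S) M).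
Proof.
move=> Mdec; have Sin (a : 'I_#|S|) : enum_val a \in S := enum_valP a.
have Sout (a : 'I_#|~: S|) : (enum_val a \in S) = false.
  by have := enum_valP a; rewrite inE => /negPf.
have eL a : set_split (lshift #|~: S| a) = enum_val a.
  by rewrite /set_split (unsplitK (inl a)).
have eR a : set_split (rshift #|S| a) = enum_val a.
  by rewrite /set_split (unsplitK (inr a)).
rewrite -[LHS]submxK; congr block_mx; apply/matrixP => i j; rewrite !mxE ?eL ?eR //.
  by apply: Mdec; rewrite Sin Sout.
by apply: Mdec; rewrite Sin Sout.
Qed.

Lemma decoupledC n (S : {set 'I_n}) M : decoupled S M -> decoupled (~: S) M.
Proof.
move=> Mdec i j; rewrite !inE => /= ij; apply: Mdec.
by case: (_ \in _) (_ \in _) ij => [] [].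
Qed.

Lemma decoupled_comm n (S : {set 'I_n}) (A B : 'M[C]_n) :
  decoupled S A -> decoupled S B ->
  restr S A *m restr S B = restr S B *m restr S A ->
  restr (~: S) A *m restr (~: S) B = restr (~: S) B *m restr (~: S) A ->
  A *m B = B *m A.
Proof.
move=> Ad Bd comS comC; set h := @set_split n S.
have hbij : bijective h by exact: set_split_bij.
have sW := select_unitary hbij; set W := rowsub h 1%:M in sW.
apply: (conj_inj sW); rewrite -!(mul_conj _ _ sW) !select_conj !decoupled_block //.
by rewrite !mulmx_block !(mulmx0, mul0mx, addr0, add0r) comS comC.
Qed.

Lemma det_rotated_congr n (V U B : 'M[C]_n) : U *m U^t* = 1%:M ->
  \det (V^t* *m (U *m B *m U^t* ) *m V) = \det (V *m V^t* *m B).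
Proof.
move=> UU; have E : \det U * \det (U^t* ) = 1 by rewrite -det_mulmx UU det1.
rewrite !det_mulmx.
transitivity (\det U * \det (U^t* ) * (\det V * \det (V^t* ) * \det B)).
  by ring.
by rewrite E mul1r.
Qed.

Lemma mul_delta_mxE n (a b : 'I_n) (M : 'M[C]_n) k l :
  (delta_mx a b *m M) k l = (k == a)%:R * M b l.
Proof.
rewrite mxE (bigD1 b) //= big1 ?addr0 => [|r rb]; first by rewrite mxE eqxx andbT.
by rewrite mxE (negPf rb) andbF mul0r.
Qed.

(** The rotation of the plane of i and j generated by t really mixes the two
    coordinates: otherwise the entries (i, j) and (j, j) of the equation give
    U j j = 1 and t = - t. *)
Lemma cayley_plane_neq0 n (i j : 'I_n) (t : C) (U : 'M[C]_n) : i != j -> t != 0 ->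
  (1%:M - t *: (delta_mx j i - delta_mx i j)) *m U =
    1%:M + t *: (delta_mx j i - delta_mx i j) -> U i j != 0.
Proof.
move=> ij t0 UE; apply/eqP => Uij.
have entry k : U k j - t * ((k == j)%:R * U i j - (k == i)%:R * U j j) =
    (k == j)%:R - t * (k == i)%:R.
  set T := delta_mx j i - delta_mx i j in UE *.
  have TU : (T *m U) k j = (k == j)%:R * U i j - (k == i)%:R * U j j.
    rewrite mulmxBl [LHS]mxE mul_delta_mxE; congr (_ + _).
    by rewrite [LHS]mxE mul_delta_mxE.
  transitivity (((1%:M - t *: T) *m U) k j).
    rewrite mulmxBl mul1mx -scalemxAl [RHS]mxE; congr (_ + _).
    by rewrite [RHS]mxE; congr (- _); rewrite [RHS]mxE TU.
  rewrite UE !mxE eqxx [j == i]eq_sym (negPf ij).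
  by rewrite andbF andbT sub0r mulrN.
pose simp := (oppr0, addr0, add0r, mulr0, mul0r, mulr1, mul1r, subr0, sub0r,
  mulr1n, mulr0n, mulrN, opprK).
have := entry j; rewrite eqxx [j == i]eq_sym (negPf ij) Uij !simp => Ujj.
have := entry i; rewrite eqxx (negPf ij) Uij Ujj !simp.
move/eqP; rewrite -subr_eq0 opprK -mulr2n -mulr_natl mulf_eq0 pnatr_eq0 /=.
by rewrite (negPf t0).
Qed.

(** One of Y + Y^* and i (Y - Y^* ) is nonscalar, for Y is a combination of
    both. *)
Lemma comm_hermitian n (A B Y : 'M[C]_n) : A^t* = A -> B^t* = B ->
  Y *m A = A *m Y -> Y *m B = B *m Y -> ~ (exists c, Y = c%:M) ->
  exists K : 'M[C]_n, [/\ K^t* = K, K *m A = A *m K, K *m B = B *m K &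
    ~ (exists c, K = c%:M)].
Proof.
move=> Ah Bh YA YB Yns.
have comm_adj (M : 'M[C]_n) : M^t* = M -> Y *m M = M *m Y -> Y^t* *m M = M *m Y^t*.
  by move=> Mh YM; rewrite -{1}Mh -adjM -YM adjM Mh.
have YsA := comm_adj _ Ah YA; have YsB := comm_adj _ Bh YB.
have adjiZ (M : 'M[C]_n) : ('i *: M)^t* = - 'i *: M^t*.
  by apply/matrixP => i j; rewrite adjE [in LHS]mxE rmorphM /= conjCi [RHS]mxE adjE.
have [[c Yc]|Rns] := EM (exists c, Y + Y^t* = c%:M); last first.
  exists (Y + Y^t* ); split=> //; first by rewrite adjD trmxCK addrC.
    by rewrite mulmxDl mulmxDr YA YsA.
  by rewrite mulmxDl mulmxDr YB YsB.
exists ('i *: (Y - Y^t* )); split.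
- by rewrite adjiZ adjD adjN trmxCK scaleNr -scalerN opprB.
- by rewrite -scalemxAl -scalemxAr mulmxBl mulmxBr YA YsA.
- by rewrite -scalemxAl -scalemxAr mulmxBl mulmxBr YB YsB.
case=> c' Yc'; apply: Yns; exists (2^-1 * (c - 'i * c')).
have Y2 : 2 *: Y = (Y + Y^t* ) + (Y - Y^t* ).
  by rewrite addrACA subrr addr0 scaler_nat mulr2n.
have YB' : Y - Y^t* = (- 'i * c')%:M.
  rewrite -scale_scalar_mx -Yc' scalerA mulNr -expr2 sqrCi opprK.
  by rewrite scale1r.
rewrite -scale_scalar_mx -[LHS](scalerK (a := 2)) ?pnatr_eq0 //; congr (_ *: _).
by rewrite Y2 Yc YB' -raddfD mulNr.
Qed.

(** A + i B is normal, and A and B are combinations of it and its adjoint. *)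
Lemma comm_hermitian_diag n (A B : 'M[C]_n) : A^t* = A -> B^t* = B ->
  A *m B = B *m A -> exists P : 'M[C]_n,
  [/\ P *m P^t* = 1%:M, P^t* *m P = 1%:M,
      forall i j, i != j -> (P *m A *m P^t* ) i j = 0 &
      forall i j, i != j -> (P *m B *m P^t* ) i j = 0].
Proof.
move=> Ah Bh AB; pose N := A + 'i *: B.
have Ns : N^t* = A - 'i *: B.
  rewrite adjD Ah; congr (_ + _); rewrite -[in RHS]Bh -scaleNr.
  by apply/matrixP => i j; rewrite adjE [in LHS]mxE rmorphM /= conjCi [RHS]mxE adjE.
have /orthomx_spectralP : N \is normalmx.
  apply/normalmxP; rewrite Ns /N; set D := 'i *: B.
  have AD : A *m D = D *m A by rewrite -scalemxAl -scalemxAr AB.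
  rewrite mulmxDl mulmxBl !mulmxBr !mulmxDr AD opprD.
  by rewrite addrA addrNK addrA addrK.
have Pu := spectral_unitarymx N; rewrite invmx_unitary //.
move: Pu; set P := spectralmx N; move=> /unitarymxP PP NE; exists P.
have sP : P^t* *m P = 1%:M by exact: mulmx1C.
have PN : P *m N *m P^t* = diag_mx (spectral_diag N).
  by rewrite {1}NE !mulmxA PP mul1mx -mulmxA PP mulmx1.
have Noff i j : i != j -> (P *m N *m P^t* ) i j = 0.
  by move=> /negPf ij; rewrite PN mxE ij.
have Nsoff i j : i != j -> (P *m N^t* *m P^t* ) i j = 0.
  by rewrite -adj_conj adjE eq_sym => /Noff->; rewrite conjC0.
have PD M L : P *m M *m P^t* + P *m L *m P^t* = P *m (M + L) *m P^t*.
  by rewrite mulmxDr mulmxDl.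
have PB M L : P *m M *m P^t* - P *m L *m P^t* = P *m (M - L) *m P^t*.
  by rewrite mulmxBr mulmxBl.
have sumE : P *m A *m P^t* + P *m A *m P^t* = P *m N *m P^t* + P *m N^t* *m P^t*.
  by rewrite !PD Ns /N addrACA subrr addr0.
have difE : 'i *: (P *m B *m P^t* + P *m B *m P^t* ) =
    P *m N *m P^t* - P *m N^t* *m P^t*.
  rewrite PD PB Ns /N opprD opprK addrACA subrr add0r.
  by rewrite -scalerDr -scalemxAr -scalemxAl.
have half (x : C) : x + x = 0 -> x = 0.
  by move=> /eqP; rewrite -mulr2n mulrn_eq0 /= => /eqP.
(* The right-hand sides of sumE and difE are diagonal. *)
split=> // i j ij; apply: half.
  have /matrixP/(_ i j) := sumE.
  by rewrite [LHS]mxE [RHS]mxE Noff // Nsoff // addr0.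
have /matrixP/(_ i j) := difE.
rewrite [LHS]mxE [X in _ * X]mxE [RHS]mxE Noff // add0r [RHS]mxE Nsoff // oppr0.
by move/eqP; rewrite mulf_eq0 (negPf (neq0Ci C)) => /eqP.
Qed.

End Reduction.

Local Open Scope complex_scope.

(** * Real spectra and simultaneous diagonalization *)

Section Spectra.
Context {R : realType}.
Local Notation C := R[i].

Definition rdiag n (mu : 'I_n -> R) : 'M[C]_n := diag_mx (\row_i (mu i)%:C).

Definition real_spectrum n (M : 'M[C]_n) (s : seq R) : Prop :=
  char_poly M = \prod_(x <- s) ('X - (x%:C)%:P).

Lemma conjC_real (a : R) : ((a%:C)%C^* = a%:C%C :> C)%R.
Proof. exact: conjc_real. Qed.

Lemma adjZr m n (a : R) (A : 'M[C]_(m, n)) : (a%:C *: A)^t* = a%:C *: A^t*.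
Proof.
apply/matrixP => i j; rewrite !mxE rmorphM /=; congr (_ * _).
exact: conjC_real.
Qed.

Lemma adj_rdiag n (mu : 'I_n -> R) : (rdiag mu)^t* = rdiag mu.
Proof.
rewrite /rdiag tr_diag_mx map_diag_mx; congr diag_mx.
by apply/rowP => i; rewrite !mxE; exact: conjC_real.
Qed.

Lemma rdiagE n (mu : 'I_n -> R) i j : rdiag mu i j = (mu i)%:C *+ (i == j).
Proof. by rewrite !mxE. Qed.

Lemma mul_rdiagl m n (mu : 'I_n -> R) (A : 'M[C]_(n, m)) i j :
  (rdiag mu *m A) i j = (mu i)%:C * A i j.
Proof. by rewrite mul_diag_mx !mxE. Qed.

Lemma mul_rdiagr m n (mu : 'I_n -> R) (A : 'M[C]_(m, n)) i j :
  (A *m rdiag mu) i j = A i j * (mu j)%:C.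
Proof. by rewrite mul_mx_diag !mxE. Qed.

Lemma real_spectrum_rdiag n (mu : 'I_n -> R) :
  real_spectrum (rdiag mu) (codom mu).
Proof.
rewrite /real_spectrum char_poly_trig ?diag_mx_is_trig //.
rewrite big_map big_enum; apply: eq_bigr => i _; by rewrite rdiagE eqxx.
Qed.

Lemma real_spectrum_block m n (A : 'M[C]_m) (B : 'M[C]_n) s u :
  real_spectrum A s -> real_spectrum B u ->
  real_spectrum (block_mx A 0 0 B) (s ++ u).
Proof.
rewrite /real_spectrum /char_poly char_block_diag_mx det_ublock => -> ->.
by rewrite big_cat.
Qed.

Lemma real_spectrum_size n (A : 'M[C]_n) s : real_spectrum A s -> size s = n.
Proof.
move=> /(congr1 (size \o val)) /=; rewrite size_char_poly.
have -> : \prod_(x <- s) ('X - (x%:C)%:P) =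
   \prod_(z <- [seq x%:C | x <- s]) ('X - z%:P) :> {poly C} by rewrite big_map.
by rewrite size_prod_XsubC size_map => -[].
Qed.

Lemma eigvalsE n (A : 'M[C]_n) s : real_spectrum A s ->
  eigvals A = \row_i (sort >=%R s)`_i.
Proof.
move=> sA; apply/rowP => i; rewrite !mxE; congr (nth _ _ _).
apply/perm_sortP.
- by move=> x y; exact: ge_total.
- by move=> x y z yx xz; exact: le_trans xz yx.
- by move=> x y; rewrite andbC => /le_anti.
rewrite /char_roots; case: closed_field_poly_normal => z /= zA.
have {}zA : char_poly A = \prod_(x <- z) ('X - x%:P).
  by rewrite {1}zA (monicP (char_poly_monic A)) scale1r.
have: perm_eq z [seq x%:C | x <- s] by apply: prod_XsubC_eq; rewrite big_map -sA.
by move/(perm_map (@complex.Re R)); rewrite -!map_comp map_id.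
Qed.

Lemma hermitian_diag n (A : 'M[C]_n) : A^t* = A ->
  exists P, exists mu : 'I_n -> R,
    [/\ P *m P^t* = 1%:M, P^t* *m P = 1%:M & A = P^t* *m rdiag mu *m P].
Proof.
move/hermP => Aherm; have := hermitian_spectral_diag_real Aherm.
have := Aherm => /hermitian_normalmx/orthomx_spectralP.
have Pu := spectral_unitarymx A; rewrite invmx_unitary //.
move: Pu; set P := spectralmx A; set D := spectral_diag A => Pu AE /mxOverP Dr.
exists P, (fun i => complex.Re (D 0 i)); split; first exact/unitarymxP.
  by rewrite -invmx_unitary // mulVmx // unitarymx_unit.
have DE : D = \row_i (complex.Re (D 0 i))%:C.
  by apply/rowP => i; rewrite mxE; apply/esym/RRe_real/Dr.
by rewrite [LHS]AE [X in diag_mx X]DE.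
Qed.

Lemma rdiag_cst n (mu : 'I_n -> R) : (forall i j, mu i = mu j) ->
  exists c, rdiag mu = c%:M.
Proof.
case: n mu => [|n] mu eq_mu; first by exists 0; apply/matrixP => -[].
exists (mu ord0)%:C; apply/matrixP => i j.
by rewrite rdiagE mxE (eq_mu i ord0).
Qed.

Lemma posdefmx_congr m n (A : 'M[C]_n) (P : 'M[C]_(n, m)) (Q : 'M[C]_(m, n)) :
  Q *m P = 1%:M -> posdefmx A -> posdefmx (P^t* *m A *m P).
Proof.
move=> QP [/hermP Ah Apos]; split.
  by apply/hermP; rewrite !adjM trmxCK Ah mulmxA.
move=> v v0; have := Apos (P *m v); rewrite adjM !mulmxA; apply.
by apply: contraNneq v0 => Pv0; rewrite -[v]mul1mx -QP -mulmxA Pv0 mulmx0.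
Qed.

Lemma posdef_rdiag n (mu : 'I_n -> R) : posdefmx (rdiag mu) -> forall i, 0 < mu i.
Proof.
move=> [_ Dpos] i; have := Dpos (delta_mx i 0).
have -> : ((delta_mx i 0)^t* *m rdiag mu *m delta_mx i 0 : 'M[C]_1) 0 0 = (mu i)%:C.
  rewrite trmx_delta map_delta_mx -rowE -colE !mxE eqxx mulr1n //.
rewrite ltcR; apply; apply/eqP => /matrixP/(_ i 0); rewrite !mxE !eqxx.
by apply/eqP; exact: oner_neq0.
Qed.

(** A congruence by A^(-1/2) turns A into the identity, and then a unitary
    conjugation diagonalizes B. *)
Lemma simultaneous_diag n (A B : 'M[C]_n) : posdefmx A -> posdefmx B ->
  exists V, exists mu : 'I_n -> R, [/\ V^t* *m A *m V = 1%:M,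
     V^t* *m B *m V = rdiag mu & forall i, 0 < mu i].
Proof.
move=> Apd Bpd; have [/hermP Ah _] := Apd.
have [P [a [PP PsP AE]]] := hermitian_diag Ah.
have a0 : forall i, 0 < a i.
  apply: posdef_rdiag; have := posdefmx_congr (P := P^t* ) PP Apd.
  by rewrite trmxCK AE !mulmxA PP mul1mx -mulmxA PP mulmx1.
pose S := rdiag (fun i => (Num.sqrt (a i))^-1).
pose S' := rdiag (fun i => Num.sqrt (a i)).
have SS : S' *m S = 1%:M.
  apply/matrixP => i j; rewrite mul_rdiagl rdiagE !mxE; case: eqVneq => [->|_].
    by rewrite -rmorphM /= divff // gt_eqF // sqrtr_gt0.
  by rewrite mulr0.
pose V0 := P^t* *m S.
have V0A : V0^t* *m A *m V0 = 1%:M.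
  rewrite /V0 adjM trmxCK adj_rdiag AE !mulmxA -[S *m P *m _]mulmxA PP mulmx1.
  rewrite -[_ *m P *m _]mulmxA PP mulmx1.
  apply/matrixP => i j; rewrite mul_rdiagr mul_rdiagl rdiagE !mxE.
  case: eqVneq => [->|_]; last by rewrite mulr0n mulr0 mul0r.
  rewrite -!rmorphM /= -{2}(sqr_sqrtr (ltW (a0 j))) expr2.
  by rewrite mulrA mulVf ?mul1r ?divff // gt_eqF // sqrtr_gt0.
have QV0 : (S' *m P) *m V0 = 1%:M by rewrite /V0 mulmxA -[_ *m P *m _]mulmxA PP mulmx1.
move: V0A QV0; move: (S' *m P) => Q0; clearbody V0 => V0A QV0.
have Bpd' := posdefmx_congr QV0 Bpd.
have [/hermP Bh _] := Bpd'.
have [Q [mu [QQ QsQ BE]]] := hermitian_diag Bh.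
exists (V0 *m Q^t* ), mu; split.
- by rewrite adjM trmxCK !mulmxA -[_ *m A]mulmxA -[_ *m V0]mulmxA V0A mulmx1 QQ.
- rewrite adjM trmxCK !mulmxA -[_ *m B]mulmxA -[_ *m V0]mulmxA BE.
  by rewrite !mulmxA QQ mul1mx -mulmxA QQ mulmx1.
apply: posdef_rdiag; have := posdefmx_congr (P := Q^t* ) QQ Bpd'.
by rewrite trmxCK BE !mulmxA QQ mul1mx -mulmxA QQ mulmx1.
Qed.

Lemma posdef_unit n (A : 'M[C]_n) : posdefmx A -> A \in unitmx.
Proof.
move=> Apd; have [V [mu [VA _ _]]] := simultaneous_diag Apd Apd.
by have /mulmx1_unit[_] := VA; move: (VA); rewrite -mulmxA => /mulmx1C;
  rewrite -mulmxA => /mulmx1_unit[].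
Qed.

(** V^* A is the inverse of V, hence A^-1 B = V diag(mu) V^-1. *)
Lemma real_spectrum_pencil n (A B V : 'M[C]_n) (mu : 'I_n -> R) :
  A \in unitmx -> V^t* *m A *m V = 1%:M -> V^t* *m B *m V = rdiag mu ->
  real_spectrum (invmx A *m B) (codom mu).
Proof.
move=> Au VA VB; have VV : V *m (V^t* *m A) = 1%:M by apply: mulmx1C.
have -> : invmx A = V *m V^t* by rewrite -[RHS](mulmxK Au) -[V *m _ *m A]mulmxA VV mul1mx.
have -> : V *m V^t* *m B = V *m rdiag mu *m (V^t* *m A).
  by rewrite -VB -!mulmxA VV mulmx1.
by rewrite /real_spectrum char_poly_sim // real_spectrum_rdiag.
Qed.

End Spectra.

(** * Logarithms of perturbed doubly stochastic averages *)

Section LogPerturbation.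
Context {R : realType}.

Lemma ln1D_ge (u : R) : `|u| <= 1 / 2 -> u - 2 * u ^+ 2 <= ln (1 + u).
Proof.
move=> u12; have : - (1/2) <= u <= 1/2 by rewrite -ler_norml.
move=> /andP[um uM]; have u1 : 0 < 1 + u by lra.
have : ln (1 + (- u / (1 + u))) <= - u / (1 + u).
  by apply: le_ln1Dx; rewrite ltr_pdivlMr //; lra.
have -> : 1 + - u / (1 + u) = (1 + u)^-1 by field; rewrite gt_eqF.
rewrite lnV ?posrE // mulNr lerN2; apply: le_trans.
rewrite ler_pdivlMr //; nra.
Qed.

Lemma ln_convex_comb n (p z : 'I_n -> R) y : (forall k, 0 <= p k) ->
  \sum_k p k = 1 -> (forall k, 0 < z k) -> \sum_k p k * z k <= y ->
  \sum_k p k * ln (z k) <= ln y.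
Proof.
move=> p0 p1 z0 le_y; set m := \sum_k p k * ln (z k).
(* Convexity of the exponential: its tangent at m lies below its graph. *)
have em : expR m <= \sum_k p k * z k.
  have -> : expR m = \sum_k p k * (expR m * (1 + (ln (z k) - m))).
    under eq_bigr do rewrite mulrCA.
    rewrite -mulr_sumr; under eq_bigr do rewrite mulrDr mulr1 mulrBr.
    by rewrite big_split /= sumrB p1 -mulr_suml p1 mul1r subrr addr0 mulr1.
  apply: ler_sum => k _; apply: ler_wpM2l => //.
  rewrite -[leRHS]lnK ?posrE // -{2}(subrK m (ln (z k))) expRD mulrC.
  by rewrite ler_pM2r ?expR_gt0 // expR_ge1Dx.
rewrite -[m]expRK ler_ln ?posrE ?expR_gt0 //; first exact: le_trans em le_y.
exact: lt_le_trans (expR_gt0 m) (le_trans em le_y).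
Qed.

(** Jensen inequality for the perturbed averages, with the quadratic error moved
    out of the logarithm through ln (1 + u) >= u - 2 u^2. *)
Lemma ln_perturb n (x delta : 'I_n -> R) (K : R) :
  exists2 t1 : R, 0 < t1 &
  exists K3 : R, forall (t : R) (p : 'I_n -> R) (y : R), 0 < t < t1 ->
    (forall k, 0 <= p k) -> \sum_k p k = 1 ->
    \sum_k p k * (expR (x k) * (1 + t * delta k) - K * t ^+ 2) <= y ->
    \sum_k p k * (x k + t * delta k) - K3 * t ^+ 2 <= ln y.
Proof.
(* K2 absorbs the factor exp (x k): K <= K2 exp (x k) for every k. *)
pose D := \sum_k `|delta k|; pose K2 := `|K| * \sum_k expR (- x k).
have D0 : 0 <= D by exact: sumr_ge0.
have e0 : 0 <= \sum_k expR (- x k) by apply: sumr_ge0 => k _; exact: expR_ge0.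
have K20 : 0 <= K2 by rewrite mulr_ge0.
pose c := D + K2 + 1; have c1 : 1 <= c by rewrite /c; lra.
have c0 : 0 < c by lra.
exists (1 / (2 * c)); first by rewrite divr_gt0 // mulr_gt0.
exists (K2 + 2 * c ^+ 2) => t p y /andP[t0]; rewrite ltr_pdivlMr ?mulr_gt0 // => tc.
move=> p0 p1 ley.
have t1 : t <= 1 by nra.
pose u k := t * delta k - K2 * t ^+ 2.
have uc k : `|u k| <= t * c.
  rewrite /u; apply: le_trans (ler_normB _ _) _.
  rewrite normrM (gtr0_norm t0) [`|K2 * _|]ger0_norm; last by rewrite mulr_ge0 ?sqr_ge0.
  have dD : `|delta k| <= D by rewrite /D (bigD1 k) //= lerDl sumr_ge0.
  have : t * `|delta k| <= t * D by rewrite ler_pM2l.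
  have : K2 * t ^+ 2 <= K2 * t.
    by apply: ler_wpM2l => //; rewrite expr2 ler_piMr // ltW.
  by rewrite /c; lra.
have u12 k : `|u k| <= 1 / 2 by apply: le_trans (uc k) _; lra.
have u1 k : 0 < 1 + u k by have := u12 k; rewrite ler_norml => /andP[]; lra.
have zle k : expR (x k) * (1 + u k) <= expR (x k) * (1 + t * delta k) - K * t ^+ 2.
  rewrite /u addrA mulrBr lerD2l lerN2 [leRHS]mulrA /K2.
  apply: ler_wpM2r; first exact: sqr_ge0.
  apply: le_trans (ler_norm K) _; rewrite mulrCA ler_peMr //.
  rewrite (bigD1 k) //= mulrDr -expRD subrr expR0 lerDl mulr_ge0 ?expR_ge0 //.
  by apply: sumr_ge0 => l _; exact: expR_ge0.
have := @ln_convex_comb n p (fun k => expR (x k) * (1 + u k)) y p0 p1.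
have zpos k : 0 < expR (x k) * (1 + u k) by rewrite mulr_gt0 ?expR_gt0.
move=> /(_ zpos) comb; apply: le_trans (comb _); last first.
  by apply: le_trans ley; apply: ler_sum => k _; exact: ler_wpM2l.
rewrite -[X in _ - X]mul1r -{1}p1 mulr_suml -sumrB.
apply: ler_sum => k _; rewrite -mulrBr; apply: ler_wpM2l => //.
rewrite lnM ?posrE ?expR_gt0 // expRK.
apply: le_trans (lerD (lexx (x k)) (ln1D_ge (u12 k))).
have : u k ^+ 2 <= (t * c) ^+ 2.
  by rewrite -[u k ^+ 2]real_normK ?num_real // ler_sqr ?nnegrE // ?mulr_ge0 // ltW.
by rewrite exprMn /u; lra.
Qed.

(** The real-variable core of the irreducible case, with expR (x k) for the
    eigenvalue mu k. By [ln_perturb] the sum of ln (y i) over a subset I is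
    bounded below by an average of the entries of x moved towards their mean;
    the weight of x k in it is the sum of p i k over i in I. *)
Lemma strict_maj_log_near n (x : 'I_n -> R) (K : R) : (exists k l, x k < x l) ->
  exists2 t0 : R, 0 < t0 & forall t (y : 'I_n -> R) (p : 'I_n -> 'I_n -> R),
    0 < t < t0 -> (forall i k, 0 <= p i k) ->
    (forall i, \sum_k p i k = 1) -> (forall k, \sum_i p i k = 1) ->
    (forall i, \sum_k p i k * (expR (x k) *
        (1 + t * ((\sum_i x i) / n%:R - x k)) - K * t ^+ 2) <= y i) ->
    \sum_i ln (y i) = \sum_i x i ->
    strict_maj (codom (fun i => ln (y i))) (codom x).
Proof.
move=> ncst; set m := _ / _.
have [t1 t1_gt0 [K3 logK]] := ln_perturb x (fun k => m - x k) K.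
have [t2 t2_gt0 near_maj] := strict_maj_near (`|K3| * n%:R) ncst.
exists (Num.min t1 t2); first by rewrite lt_min t1_gt0.
move=> t y p /andP[t0]; rewrite lt_min => /andP[tt1 tt2] p0 prow pcol ley eq_sum.
apply: (near_maj t (fun i => ln (y i))) => //; first by rewrite t0.
move=> I; exists (fun k => \sum_(i in I) p i k); split.
- move=> k; apply/andP; split; first exact: sumr_ge0.
  by rewrite -(pcol k) [leRHS](bigID (mem I)) /= lerDl sumr_ge0.
- rewrite exchange_big /=; under eq_bigr do rewrite prow.
  by rewrite sumr_const.
under eq_bigr do rewrite mulr_suml.
rewrite exchange_big /=.
apply: (@le_trans _ _ (\sum_(i in I)
   (\sum_k p i k * (x k + t * (m - x k)) - K3 * t ^+ 2))); last first.
  by apply: ler_sum => i _; apply: logK => //; rewrite t0.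
rewrite sumrB lerD2l lerN2 sumr_const -[_ *+ #|I|]mulr_natr [leLHS]mulrAC.
apply: ler_wpM2r; first exact: sqr_ge0.
apply: (@le_trans _ _ (`|K3| * #|I|%:R)).
  by rewrite ler_wpM2r ?ler_norm.
by rewrite ler_wpM2l // ler_nat -[leqRHS](card_ord n) max_card.
Qed.

End LogPerturbation.

(** * Entrywise norm and first-order expansions *)

Section Expansions.
Context {R : realType}.
Local Notation C := R[i].

Lemma normc_ge0 (z : C) : 0 <= Normc.normc z.
Proof. by case: z => a b; exact: sqrtr_ge0. Qed.

Lemma normc_norm (z : C) : (Normc.normc z)%:C%C = `|z|.
Proof. by rewrite normc_def; case: z. Qed.

Lemma normc_conj (z : C) : Normc.normc (z^*)%R = Normc.normc z.
Proof. by apply: complexI; rewrite !normc_norm norm_conjC. Qed.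

Lemma normc_real (a : R) : Normc.normc (a%:C%C : C) = `|a|.
Proof. by rewrite /= expr0n /= addr0 sqrtr_sqr. Qed.

Lemma Re_le_normc (z : C) : `|complex.Re z| <= Normc.normc z.
Proof.
by case: z => a b /=; rewrite -sqrtr_sqr ler_sqrt ?lerDl ?addr_ge0 ?sqr_ge0.
Qed.

(** Any submultiplicative norm would do; this one dominates the entries and,
    after a short estimate, the spectral norm. *)
Definition mnorm m n (M : 'M[C]_(m, n)) : R := \sum_i \sum_j Normc.normc (M i j).

Lemma mnorm_ge0 m n (M : 'M[C]_(m, n)) : 0 <= mnorm M.
Proof. by apply: sumr_ge0 => i _; apply: sumr_ge0 => j _; exact: normc_ge0. Qed.

Lemma entry_le_mnorm m n (M : 'M[C]_(m, n)) i j : Normc.normc (M i j) <= mnorm M.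
Proof.
rewrite /mnorm (bigD1 i) //= (bigD1 j) //= -addrA lerDl addr_ge0 //.
  by apply: sumr_ge0 => k _; exact: normc_ge0.
by apply: sumr_ge0 => k _; apply: sumr_ge0 => l _; exact: normc_ge0.
Qed.

Lemma mnormD m n (M N : 'M[C]_(m, n)) : mnorm (M + N) <= mnorm M + mnorm N.
Proof.
rewrite /mnorm -big_split; apply: ler_sum => i _ /=.
by rewrite -big_split; apply: ler_sum => j _ /=; rewrite mxE; exact: le_normcD.
Qed.

Lemma normc_sum (I : finType) (F : I -> C) :
  Normc.normc (\sum_i F i) <= \sum_i Normc.normc (F i).
Proof.
elim/big_ind2: _ => [|x x' y y' lex ley|//]; first by rewrite Normc.normc0.
exact: le_trans (le_normcD _ _) (lerD lex ley).
Qed.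

Lemma mnormM m n p (M : 'M[C]_(m, n)) (N : 'M[C]_(n, p)) :
  mnorm (M *m N) <= mnorm M * mnorm N.
Proof.
rewrite /mnorm mulr_suml; apply: ler_sum => i _.
apply: (@le_trans _ _ (\sum_j \sum_k Normc.normc (M i k) * Normc.normc (N k j))).
  apply: ler_sum => j _; rewrite mxE; apply: le_trans (normc_sum _) _.
  by apply: ler_sum => k _; rewrite Normc.normcM.
rewrite exchange_big mulr_suml /=; apply: ler_sum => k _; rewrite -mulr_sumr.
apply: ler_wpM2l; first exact: normc_ge0.
rewrite [leRHS](bigD1 k) //= lerDl; apply: sumr_ge0 => l _.
by apply: sumr_ge0 => j _; exact: normc_ge0.
Qed.

Lemma mnormZ m n (a : C) (M : 'M[C]_(m, n)) : mnorm (a *: M) = Normc.normc a * mnorm M.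
Proof.
rewrite /mnorm mulr_sumr; apply: eq_bigr => i _; rewrite mulr_sumr.
by apply: eq_bigr => j _; rewrite mxE Normc.normcM.
Qed.

Lemma mnorm_adj m n (M : 'M[C]_(m, n)) : mnorm (M^t* ) = mnorm M.
Proof.
rewrite /mnorm exchange_big; apply: eq_bigr => i _; apply: eq_bigr => j _.
by rewrite !mxE; exact: normc_conj.
Qed.

Lemma unitary_row_sum n (U : 'M[C]_n) i : U *m U^t* = 1%:M ->
  \sum_k Normc.normc (U i k) ^+ 2 = 1.
Proof.
move=> /matrixP/(_ i i); rewrite !mxE eqxx => UU; apply: complexI.
rewrite rmorph_sum /= -[RHS]UU; apply: eq_bigr => k _.
by rewrite rmorphXn /= normc_norm !mxE normCK.
Qed.

Lemma mnorm_unitary n (U : 'M[C]_n) : U *m U^t* = 1%:M -> mnorm U <= n%:R ^+ 2.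
Proof.
move=> UU; rewrite /mnorm.
apply: (@le_trans _ _ (\sum_(i < n) \sum_(j < n) (1 : R))); last first.
  by rewrite !sumr_const !card_ord -mulrnA expr2 -natrM.
apply: ler_sum => i _; apply: ler_sum => j _.
rewrite -(@ler_pXn2r _ 2) ?nnegrE ?normc_ge0 // expr1n -(unitary_row_sum i UU).
by rewrite (bigD1 j) //= lerDl; apply: sumr_ge0 => k _; exact: sqr_ge0.
Qed.

Definition expands n (F : R -> 'M[C]_n) (F0 F1 : 'M[C]_n) : Prop :=
  exists K : R, forall t, 0 <= t <= 1 ->
    mnorm (F t - (F0 + t%:C%C *: F1)) <= K * t ^+ 2.

Lemma expands_cst n (M : 'M[C]_n) : expands (fun=> M) M 0.
Proof.
exists 0 => t _; rewrite scaler0 addr0 subrr mul0r /mnorm big1 // => i _.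
by rewrite big1 // => j _; rewrite mxE Normc.normc0.
Qed.

Lemma expands_adj n (F : R -> 'M[C]_n) F0 F1 : expands F F0 F1 ->
  expands (fun t => (F t)^t* ) (F0^t* ) (F1^t* ).
Proof.
case=> K FK; exists K => t t01; rewrite -adjZr -adjD -adjN -adjD mnorm_adj.
exact: FK.
Qed.

Lemma expandsM n (F G : R -> 'M[C]_n) F0 F1 G0 G1 :
  expands F F0 F1 -> expands G G0 G1 ->
  expands (fun t => F t *m G t) (F0 *m G0) (F0 *m G1 + F1 *m G0).
Proof.
case=> K FK [L GL]; pose f := mnorm F0 + mnorm F1; pose g := mnorm G0 + mnorm G1.
have f0 : 0 <= f by rewrite addr_ge0 ?mnorm_ge0.
have g0 : 0 <= g by rewrite addr_ge0 ?mnorm_ge0.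
exists (mnorm F1 * mnorm G1 + f * L + K * (g + L)) => t /andP[t0 t1].
have t01 : 0 <= t <= 1 by rewrite t0.
have tC : Normc.normc (t%:C%C : C) = t by rewrite normc_real ger0_norm.
have affine_le (M N : 'M[C]_n) :
    mnorm (M + t%:C%C *: N) <= mnorm M + mnorm N.
  apply: le_trans (mnormD _ _) _; rewrite lerD2l mnormZ tC.
  by rewrite ler_piMl // mnorm_ge0.
set E := F t - (F0 + t%:C%C *: F1); set H := G t - (G0 + t%:C%C *: G1).
have EK : mnorm E <= K * t ^+ 2 by exact: FK.
have HL : mnorm H <= L * t ^+ 2 by exact: GL.
have L0 : 0 <= L * t ^+ 2 := le_trans (mnorm_ge0 _) HL.
have GtL : mnorm (G t) <= g + L.
  have -> : G t = (G0 + t%:C%C *: G1) + H by rewrite /H addrC subrK.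
  apply: le_trans (mnormD _ _) (lerD (affine_le _ _) _).
  have L1 : 0 <= L.
    have := GL 1; rewrite lexx ler01 expr1n mulr1 => /(_ isT).
    exact: le_trans (mnorm_ge0 _).
  by apply: le_trans HL _; rewrite ler_piMr // expr_le1.
rewrite mul_first_order -/E -/H.
rewrite 2!mulrDl; apply: le_trans (mnormD _ _) (lerD _ _).
  apply: le_trans (mnormD _ _) (lerD _ _).
    rewrite mnormZ expr2 Normc.normcM tC -expr2 mulrC; apply: ler_wpM2r.
      exact: sqr_ge0.
    exact: mnormM.
  apply: le_trans (mnormM _ _) _; rewrite -mulrA.
  by apply: ler_pM; rewrite ?mnorm_ge0 // affine_le.
apply: le_trans (mnormM _ _) _; rewrite mulrAC.
by apply: ler_pM; rewrite ?mnorm_ge0.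
Qed.

Lemma skewZ n (X : 'M[C]_n) (t : R) : X^t* = - X ->
  (t%:C%C *: X)^t* = - (t%:C%C *: X).
Proof. by move=> Xsk; rewrite adjZr Xsk scalerN. Qed.

Lemma mnorm_1cayley n (K : 'M[C]_n) : K^t* = - K ->
  mnorm (1%:M + cayley K) <= 2 * n%:R ^+ 2.
Proof.
move=> Ksk; apply: le_trans (mnormD _ _) _; rewrite mulrDl mul1r; apply: lerD.
  by apply: mnorm_unitary; rewrite adj1 mulmx1.
by apply: mnorm_unitary; have [] := cayley_unitary Ksk.
Qed.

Lemma expands_cayley n (X : 'M[C]_n) : X^t* = - X ->
  expands (fun t => cayley (t%:C%C *: X)) 1%:M (2 *: X).
Proof.
move=> Xsk; exists (2 * n%:R ^+ 2 * (mnorm X * mnorm X)) => t /andP[t0 t1].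
have Ksk := skewZ t Xsk; set K := t%:C%C *: X in Ksk *.
rewrite opprD addrA scalerA mulrC -scalerA -/K cayley_expansion ?skew_unit //.
rewrite -mulrA; apply: le_trans (mnormM _ _) _.
apply: ler_pM; rewrite ?mnorm_ge0 ?mnorm_1cayley //.
apply: le_trans (mnormM _ _) _; rewrite !mnormZ normc_real ger0_norm // expr2.
by rewrite mulrACA mulrC.
Qed.

End Expansions.

(** * Rotations that decrease the spectrum: the irreducible case *)

Section Improvable.
Context {R : realType}.
Local Notation C := R[i].

(** The parameter t is taken positive, the sign being immaterial once the curve
    is made even. *)
Definition improvable n (A B : 'M[C]_n) : Prop :=
  exists2 X : 'M[C]_n, X^t* = - X & exists2 t0 : R, 0 < t0 &
  forall t, 0 < t < t0 -> let U := cayley (t%:C *: X) in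
  exists s s', [/\ real_spectrum (invmx A *m B) s,
    real_spectrum (invmx A *m (U *m B *m U^t* )) s' &
    strict_maj (map (@ln R) s') (map (@ln R) s)].

Lemma expands_congr n (V : 'M[C]_n) F F0 F1 : expands F F0 F1 ->
  expands (fun t => V^t* *m F t *m V) (V^t* *m F0 *m V) (V^t* *m F1 *m V).
Proof.
move=> FE; have := expandsM (expandsM (expands_cst (V^t* )) FE) (expands_cst V).
by rewrite mulmx0 add0r mul0mx addr0.
Qed.

(** The first-order term of the rotation is a commutator; the factor 2 comes
    from cayley (t X) = 1 + 2 t X + O(t^2). *)
Lemma expands_rotate n (X : 'M[C]_n) F F0 F1 : X^t* = - X -> expands F F0 F1 ->
  expands (fun t => cayley (t%:C *: X) *m F t *m (cayley (t%:C *: X))^t* )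
    F0 (F1 + 2 *: (X *m F0 - F0 *m X)).
Proof.
move=> Xsk FE; have XE := expands_cayley Xsk.
have := expandsM (expandsM XE FE) (expands_adj XE).
rewrite adj1 mulmx1 !mul1mx mulmx1.
have -> : (2 *: X)^t* = 2 *: - X.
  have -> : 2 = (2 : R)%:C :> C by rewrite rmorph_nat.
  by rewrite adjZr Xsk.
by rewrite rotate_first_order.
Qed.

Lemma sum_ln n (y : 'I_n -> R) : (forall i, 0 < y i) ->
  \sum_i ln (y i) = ln (\prod_i y i).
Proof.
move=> y0; suff [] : \sum_i ln (y i) = ln (\prod_i y i) /\ 0 < \prod_i y i by [].
elim/big_ind2: _ => [|a b a' b' [-> b0] [-> b'0]|i _]; rewrite ?ln1 //.
by rewrite lnM ?posrE // mulr_gt0.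
Qed.

Lemma det_rdiag n (mu : 'I_n -> R) : \det (rdiag mu) = (\prod_i mu i)%:C.
Proof. by rewrite det_diag rmorph_prod; apply: eq_bigr => i _; rewrite mxE. Qed.

Lemma codom_ln n (y : 'I_n -> R) : map (@ln R) (codom y) = codom (fun i => ln (y i)).
Proof. by rewrite /codom /image_mem -map_comp. Qed.

Lemma unitary_diag_entry n (P : 'M[C]_n) (mu : 'I_n -> R) i :
  (P *m rdiag mu *m P^t* ) i i = (\sum_k Normc.normc (P i k) ^+ 2 * mu k)%:C.
Proof.
rewrite mxE rmorph_sum; apply: eq_bigr => k _.
rewrite mul_rdiagr adjE rmorphM rmorphXn /= normc_norm normCK.
by rewrite mulrAC.
Qed.

Lemma rdiag_add n (a b : 'I_n -> R) (t : R) :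
  rdiag a + t%:C *: rdiag b = rdiag (fun i => a i + t * b i).
Proof.
apply/matrixP => i j; rewrite [LHS]mxE [X in _ + X]mxE !rdiagE.
by case: eqP => _; rewrite ?mulr1n ?mulr0n ?mulr0 ?addr0 // rmorphD rmorphM.
Qed.

(** With P unitary, the (i, i) entry of P diag(z) P^* is the average of z with
    weights |P i k|^2. The factor n^4 bounds the entrywise norms of P and P^*,
    at most n^2 each. *)
Lemma perturbed_entry_ge n (P F : 'M[C]_n) (a b : 'I_n -> R) (t K : R) i :
  P *m P^t* = 1%:M -> mnorm (F - (rdiag a + t%:C *: rdiag b)) <= K ->
  \sum_k Normc.normc (P i k) ^+ 2 * (a k + t * b k - n%:R ^+ 4 * K)
    <= complex.Re ((P *m F *m P^t* ) i i).
Proof.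
move=> PP; rewrite rdiag_add; set E := F - _ => EK.
have -> : F = rdiag (fun k => a k + t * b k) + E by rewrite /E addrC subrK.
rewrite mulmxDr mulmxDl mxE unitary_diag_entry.
under eq_bigr do rewrite mulrBr.
rewrite sumrB -mulr_suml unitary_row_sum // mul1r raddfD /=.
rewrite lerD2l; apply: le_trans (lerNnormlW (lexx _)); rewrite lerN2.
apply: le_trans (Re_le_normc _) _; apply: le_trans (entry_le_mnorm _ _ _) _.
apply: le_trans (mnormM _ _) _; rewrite mnorm_adj.
have PN := mnorm_unitary PP.
apply: (@le_trans _ _ ((n%:R ^+ 2 * K) * n%:R ^+ 2)); last by rewrite mulrAC -exprD.
apply: ler_pM; rewrite ?mnorm_ge0 //; apply: le_trans (mnormM _ _) _.
by apply: ler_pM; rewrite ?mnorm_ge0.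
Qed.

(** The congruence V is corrected by the unitary factors w and P, so the entries
    y are both the spectrum of the rotated pencil and the eigenvalues of the
    Hermitian matrix between P and P^*. *)
Lemma rotated_pencil n (A B V u w : 'M[C]_n) (mu : 'I_n -> R) :
  posdefmx A -> posdefmx B ->
  V^t* *m A *m V = 1%:M -> V^t* *m B *m V = rdiag mu ->
  u *m u^t* = 1%:M -> w *m w^t* = 1%:M ->
  exists P, exists y : 'I_n -> R,
    [/\ P *m P^t* = 1%:M, P^t* *m P = 1%:M,
    P *m (w *m (V^t* *m (u *m B *m u^t* ) *m V) *m w^t* ) *m P^t* = rdiag y,
    real_spectrum (invmx A *m (u *m B *m u^t* )) (codom y) &
    (forall i, 0 < y i) /\ \prod_i y i = \prod_i mu i].
Proof.
move=> Apd Bpd VA VB uu ww; have [/hermP Bh _] := Bpd.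
set B' := u *m B *m u^t*; set M := w *m _ *m _.
have B'pd : posdefmx B'.
  have := posdefmx_congr (P := u^t* ) uu Bpd; by rewrite trmxCK.
have Mh : M^t* = M by rewrite /M (adj_conj w) (adj_congr V) /B' (adj_conj u) Bh.
have [P [y [PP PsP MP]]] := hermitian_diag Mh.
have PM : P *m M *m P^t* = rdiag y.
  by rewrite MP !mulmxA PP mul1mx -mulmxA PP mulmx1.
pose S := V *m w^t* *m P^t*.
have SA : S^t* *m A *m S = 1%:M.
  by have := congr_mul_adj2 V w P A; rewrite VA mulmx1 ww mulmx1 PP.
have SB : S^t* *m B' *m S = rdiag y.
  by rewrite -PM; exact: congr_mul_adj2.
exists P, y; split=> //; first exact: real_spectrum_pencil (posdef_unit Apd) SA SB.
split; first by apply: posdef_rdiag; rewrite -SB; exact: posdefmx_congr SA B'pd.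
apply: complexI; rewrite -!det_rdiag -PM (det_unitary_conj _ PP) (det_unitary_conj _ ww).
by rewrite -VB; apply: det_congr; exact: det_unitary_conj.
Qed.

(** The generators of [exists_isospectral_generators] for
    delta = mean(x) - x, the eigenvalues written as averages by
    [perturbed_entry_ge], and [strict_maj_log_near]. *)
Theorem irreducible_improvable n (A B : 'M[C]_n) :
  posdefmx A -> posdefmx B -> A *m B <> B *m A ->
  (forall Y : 'M[C]_n, Y *m A = A *m Y -> Y *m B = B *m Y -> exists c, Y = c%:M) ->
  improvable A B.
Proof.
move=> Apd Bpd ncomm irr; have [/hermP Ah _] := Apd; have [/hermP Bh _] := Bpd.
have [V [mu [VA VB mu0]]] := simultaneous_diag Apd Bpd.
pose x i := ln (mu i); have ex i : expR (x i) = mu i by rewrite lnK ?posrE.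
have ncst : exists k l, x k < x l.
  apply: contrapT => cst; apply: ncomm.
  have eq_mu k l : mu k = mu l.
    rewrite -ex -(ex l); congr expR; apply/eqP; rewrite eq_le !leNgt.
    by apply/andP; split; apply/negP => lt; apply: cst; [exists l, k|exists k, l].
  have [c DE] := rdiag_cst eq_mu.
  (* If mu is the constant c then B = c A. *)
  have := pencil_right VA VB; rewrite -/(rdiag mu) DE mul_mx_scalar -scalemxAl.
  move=> ->; have -> : A *m V *m (V^t* *m A) = A.
    have : V *m (V^t* *m A) = 1%:M by apply: mulmx1C.
    by rewrite -mulmxA => ->; rewrite mulmx1.
  by rewrite -scalemxAr -scalemxAl.
pose m := (\sum_i x i) / n%:R.
have n0 : n%:R != 0 :> R.
  by case: ncst => k _; rewrite pnatr_eq0 -lt0n (leq_ltn_trans _ (ltn_ord k)).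
have delta0 : \sum_i (m - x i)%:C = 0 :> C.
  rewrite -rmorph_sum sumrB sumr_const card_ord -mulr_natr /m mulfVK //.
  by rewrite subrr.
have [||X [Z [Xsk Zsk XZ]]] :=
  exists_isospectral_generators VA VB irr Ah Bh delta0.
- by move=> i; exact: conjC_real.
- by move=> i; exact: conjC_real.
pose U (t : R) := cayley (t%:C *: X); pose W (t : R) := cayley (t%:C *: Z).
(* The second rotation W does not change the spectrum: it only removes the
   off-diagonal part of the first-order term. *)
pose F (t : R) := W t *m (V^t* *m (U t *m B *m (U t)^t* ) *m V) *m (W t)^t*.
have FE : expands F (rdiag mu) (rdiag (fun i => mu i * (m - x i))).
  have := expands_rotate Zsk (expands_congr V (expands_rotate Xsk (expands_cst B))).
  rewrite add0r -scalemxAr -scalemxAl [V^t* *m B *m V]VB XZ -/(rdiag mu).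
  congr (expands _ _ _); congr diag_mx.
  by apply/rowP => i; rewrite !mxE rmorphM.
have [K FK] := FE.
have [t0 t0_gt0 maj] := strict_maj_log_near (n%:R ^+ 4 * K) ncst.
exists X => //; exists (Num.min t0 1); first by rewrite lt_min t0_gt0 ltr01.
move=> t /andP[t_gt0]; rewrite lt_min => /andP[tt0 t1] Ut.
have [UU _] := cayley_unitary (skewZ t Xsk).
have [WW _] := cayley_unitary (skewZ t Zsk).
have [P [y [PP PsP PF yspec [y0 yprod]]]] :=
  rotated_pencil Apd Bpd VA VB UU WW.
exists (codom mu), (codom y); split.
- exact: real_spectrum_pencil (posdef_unit Apd) VA VB.
- exact: yspec.
have yE i : y i = complex.Re ((P *m F t *m P^t* ) i i) by rewrite PF rdiagE eqxx.
rewrite !codom_ln; apply: (maj t y (fun i k => Normc.normc (P i k) ^+ 2)).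
- by rewrite t_gt0.
- by move=> i k; exact: sqr_ge0.
- by move=> i; exact: unitary_row_sum.
- move=> k; rewrite -(unitary_row_sum (U := P^t* ) k); last by rewrite trmxCK.
  by apply: eq_bigr => i _; rewrite adjE normc_conj.
- move=> i; rewrite yE.
  have t01 : 0 <= t <= 1 by rewrite !ltW.
  apply: le_trans (perturbed_entry_ge i PP (FK t t01)).
  apply: ler_sum => k _; apply: ler_wpM2l; first exact: sqr_ge0.
  by rewrite ex -/m le_eqVlt; apply/orP; left; apply/eqP; ring.
by rewrite (sum_ln y0) yprod -(sum_ln mu0).
Qed.

End Improvable.

(** * Reduction of noncommuting pairs *)

Section Cases.
Context {R : realType}.
Local Notation C := R[i].

Lemma real_spectrum_unitary m n (W : 'M[C]_(m, n)) (M : 'M[C]_n) s :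
  W *m W^t* = 1%:M -> W^t* *m W = 1%:M ->
  real_spectrum (W *m M *m W^t* ) s -> real_spectrum M s.
Proof. by move=> WW sW; rewrite /real_spectrum char_poly_sim. Qed.

(** W may have different numbers of rows and columns syntactically, which avoids
    casts when the indices are split into two groups. *)
Lemma improvable_unitary m n (W : 'M[C]_(m, n)) (A B : 'M[C]_n) :
  W *m W^t* = 1%:M -> W^t* *m W = 1%:M -> A \in unitmx ->
  improvable (W *m A *m W^t* ) (W *m B *m W^t* ) -> improvable A B.
Proof.
move=> WW sW; have mn : m = n.
  have le_mn : (\rank (W *m W^t* ) <= n)%N :=
    leq_trans (mxrankM_maxl _ _) (rank_leq_col _).
  have le_nm : (\rank (W^t* *m W) <= m)%N :=
    leq_trans (mxrankM_maxl _ _) (rank_leq_col _).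
  move: le_mn le_nm; rewrite WW sW !mxrank1 => le_mn le_nm.
  by apply/eqP; rewrite eqn_leq le_mn.
subst m => Au [X Xsk [t0 t0_gt0 imp]].
exists (W^t* *m X *m W); first by rewrite adj_congr Xsk mulmxN mulNmx.
exists t0 => [|t tt0]; first exact: t0_gt0.
have [s [s' [sp sp' maj]]] := imp t tt0.
have -> : t%:C *: (W^t* *m X *m W) = W^t* *m (t%:C *: X) *m W.
  by rewrite -scalemxAr -scalemxAl.
rewrite (cayley_conj WW (skewZ t Xsk)).
move: (cayley _) sp' => u sp'; exists s, s'; split; last exact: maj.
  by apply: (real_spectrum_unitary WW sW); rewrite -(invmx_mul_conj _ WW Au).
apply: (real_spectrum_unitary WW sW); rewrite -(invmx_mul_conj _ WW Au).
by rewrite -(rotate_conj u B WW).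
Qed.

Lemma posdef_spectrum n (A B : 'M[C]_n) : posdefmx A -> posdefmx B ->
  exists s, real_spectrum (invmx A *m B) s.
Proof.
move=> Apd Bpd; have [V [mu [VA VB _]]] := simultaneous_diag Apd Bpd.
by exists (codom mu); exact: real_spectrum_pencil (posdef_unit Apd) VA VB.
Qed.

(** Rotate inside the first block only; the spectrum of the second block is
    common to both sides of the majorization. *)
Lemma improvable_block m k (A1 B1 : 'M[C]_m) (A2 B2 : 'M[C]_k) :
  A1 \in unitmx -> posdefmx A2 -> posdefmx B2 ->
  improvable A1 B1 -> improvable (block_mx A1 0 0 A2) (block_mx B1 0 0 B2).
Proof.
move=> A1u A2pd B2pd [X Xsk [t0 t0_gt0 imp]]; have A2u := posdef_unit A2pd.
have [u uspec] := posdef_spectrum A2pd B2pd.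
exists (block_mx X 0 0 0); first exact: skew_block.
exists t0 => [|t tt0]; first exact: t0_gt0.
have [s [s' [sp sp' maj]]] := imp t tt0.
cbv zeta; rewrite scale_block_mx !scaler0 (cayley_block _ (skewZ t Xsk)) rotate_block.
exists (s ++ u), (s' ++ u); split.
- by rewrite invmx_mul_block //; exact: real_spectrum_block.
- by rewrite invmx_mul_block //; exact: real_spectrum_block.
- by rewrite !map_cat; exact: strict_maj_cat.
Qed.

Lemma posdef_restr n (S : {set 'I_n}) (A : 'M[C]_n) :
  posdefmx A -> posdefmx (restr S A).
Proof.
move=> Apd; rewrite /restr -select_conj.
have WW := select_isometry C (@enum_val_inj _ (mem S)).
have := posdefmx_congr (P := (rowsub enum_val 1%:M)^t* ) WW Apd.
by rewrite trmxCK.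
Qed.

Lemma improvable_restr n (S : {set 'I_n}) (A B : 'M[C]_n) :
  posdefmx A -> posdefmx B -> decoupled S A -> decoupled S B ->
  improvable (restr S A) (restr S B) -> improvable A B.
Proof.
move=> Apd Bpd Ad Bd imp; have hbij := set_split_bij S.
apply: (improvable_unitary (select_isometry C (bij_inj hbij)) (select_unitary C hbij)).
  exact: posdef_unit.
rewrite !select_conj !decoupled_block //; apply: improvable_block => //.
- exact/posdef_unit/posdef_restr.
- exact: posdef_restr.
- exact: posdef_restr.
Qed.

Lemma commute_rdiag_decoupled n (kap : 'I_n -> R) (M : 'M[C]_n) i0 :
  rdiag kap *m M = M *m rdiag kap -> decoupled [set i | kap i == kap i0] M.
Proof.
move=> comm i j; rewrite !inE => ij; have /matrixP/(_ i j) := comm.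
rewrite mul_rdiagl mul_rdiagr mulrC => /eqP; rewrite -subr_eq0 -mulrBr mulf_eq0.
case/orP => [/eqP//|]; rewrite subr_eq0 => /eqP/complexI eq_kap.
by rewrite eq_kap eqxx in ij.
Qed.

(** Strong induction on the dimension. If both restrictions to an eigenspace of
    K and to its complement commuted, so would A and B. *)
Theorem noncommuting_improvable n (A B : 'M[C]_n) :
  posdefmx A -> posdefmx B -> A *m B <> B *m A -> improvable A B.
Proof.
have [N] := ubnP n; elim: N n A B => // N IHN n A B /ltnSE nN Apd Bpd ncomm.
have [irr|] := EM (forall Y : 'M[C]_n, Y *m A = A *m Y -> Y *m B = B *m Y ->
  exists c, Y = c%:M); first exact: irreducible_improvable.
move=> /existsNP[Y /not_implyP[YA /not_implyP[YB Yns]]].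
have [/hermP Ah _] := Apd; have [/hermP Bh _] := Bpd.
have [K [Kh KA KB Kns]] := comm_hermitian Ah Bh YA YB Yns.
have [P [kap [PP sP KE]]] := hermitian_diag Kh.
apply: (improvable_unitary PP sP (posdef_unit Apd)).
have PK (M : 'M[C]_n) : K *m M = M *m K ->
    rdiag kap *m (P *m M *m P^t* ) = (P *m M *m P^t* ) *m rdiag kap.
  have -> : rdiag kap = P *m K *m P^t*.
    by rewrite KE !mulmxA PP mul1mx -mulmxA PP mulmx1.
  by move=> KM; rewrite !(mul_conj _ _ sP) KM.
have A'd := PK A KA; have B'd := PK B KB.
have A'pd : posdefmx (P *m A *m P^t* ).
  have := posdefmx_congr (P := P^t* ) PP Apd; by rewrite trmxCK.
have B'pd : posdefmx (P *m B *m P^t* ).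
  have := posdefmx_congr (P := P^t* ) PP Bpd; by rewrite trmxCK.
have ncomm' : (P *m A *m P^t* ) *m (P *m B *m P^t* ) <>
              (P *m B *m P^t* ) *m (P *m A *m P^t* ).
  by rewrite !(mul_conj _ _ sP) => /(conj_inj sP).
move: (P *m A *m P^t* ) (P *m B *m P^t* ) A'd B'd A'pd B'pd ncomm'.
move=> {Ah Bh Apd Bpd KA KB YA YB ncomm} A' B' A'd B'd A'pd B'pd ncomm.
have [i0 [j0 ij0]] : exists i0 j0, kap j0 <> kap i0.
  apply: contrapT => cst; apply: Kns.
  have eq_kap i j : kap i = kap j.
    by apply: contrapT => ne; apply: cst; exists j, i.
  have [c DE] := rdiag_cst eq_kap.
  exists c; rewrite KE DE mul_mx_scalar -scalemxAl sP.
  by rewrite scalemx1.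
(* one eigenspace of K against the sum of the others *)
pose S := [set i | kap i == kap i0].
have Ad : decoupled S A' by exact: commute_rdiag_decoupled.
have Bd : decoupled S B' by exact: commute_rdiag_decoupled.
have cS : (#|S| < n)%N.
  rewrite -[X in (_ < X)%N](card_ord n) -cardsT; apply: proper_card.
  by apply/properP; split; [exact: subsetT | exists j0; rewrite ?inE //; apply/eqP].
have cSC : (#|~: S| < n)%N.
  rewrite -[X in (_ < X)%N](card_ord n) -cardsT; apply: proper_card.
  by apply/properP; split; [exact: subsetT | exists i0; rewrite ?inE ?eqxx].
have [comS|ncomS] := EM (restr S A' *m restr S B' = restr S B' *m restr S A').
  apply: (improvable_restr A'pd B'pd (decoupledC Ad) (decoupledC Bd)).
  apply: IHN; [exact: leq_trans cSC nN|exact: posdef_restr|exact: posdef_restr|].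
  by move=> comSC; apply: ncomm; exact: decoupled_comm comS comSC.
apply: (improvable_restr A'pd B'pd Ad Bd).
by apply: IHN; [exact: leq_trans cS nN|exact: posdef_restr|exact: posdef_restr|].
Qed.

End Cases.

(** * Commuting pairs *)

Section Commuting.
Context {R : realType}.
Local Notation C := R[i].

Lemma invmx_rdiag n (a : 'I_n -> R) : (forall i, 0 < a i) ->
  invmx (rdiag a) = rdiag (fun i => (a i)^-1).
Proof.
move=> a0; have E : rdiag a *m rdiag (fun i => (a i)^-1) = 1%:M.
  apply/matrixP => i j; rewrite mul_rdiagl rdiagE mxE; case: eqP => [->|_].
    by rewrite !mulr1n -rmorphM divff ?gt_eqF.
  by rewrite !mulr0n mulr0.
have [au _] := mulmx1_unit E.
by rewrite -[LHS]mulmx1 -E mulKmx.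
Qed.

Lemma mul_rdiag n (a b : 'I_n -> R) : rdiag a *m rdiag b = rdiag (fun i => a i * b i).
Proof.
apply/matrixP => i j; rewrite mul_rdiagl !rdiagE; case: eqP => [->|_].
  by rewrite !mulr1n rmorphM.
by rewrite !mulr0n mulr0.
Qed.

Lemma trace_rdiag_mul n (a : 'I_n -> R) (M : 'M[C]_n) :
  \tr (rdiag a *m M) = \sum_i (a i)%:C * M i i.
Proof. by apply: eq_bigr => i _; rewrite mul_rdiagl. Qed.

Lemma trace_rdiag n (a : 'I_n -> R) : \tr (rdiag a) = (\sum_i a i)%:C.
Proof. by rewrite /mxtrace rmorph_sum; apply: eq_bigr => i _; rewrite rdiagE eqxx. Qed.

Lemma posdef_rdiag_gt0 n (a : 'I_n -> R) : (forall i, 0 < a i) -> posdefmx (rdiag a).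
Proof.
move=> a0; split; first by apply/hermP; exact: adj_rdiag.
move=> v v0; have -> : (v^t* *m rdiag a *m v) 0 0 = \sum_i (a i)%:C * `|v i 0| ^+ 2.
  rewrite mxE; apply: eq_bigr => i _.
  by rewrite mul_rdiagr adjE normCK [_ * (a i)%:C]mulrC -mulrA [_ * v i 0]mulrC.
have term_ge0 i : 0 <= (a i)%:C * `|v i 0| ^+ 2.
  by rewrite mulr_ge0 ?exprn_ge0 // ler0c ltW.
have [i vi] : exists i, v i 0 != 0.
  apply: contrapT => vz; move/eqP: v0; apply; apply/colP => i; rewrite [RHS]mxE.
  by apply: contrapT => ne; apply: vz; exists i; apply/eqP.
rewrite (bigD1 i) //= ltr_pwDl //; last by apply: sumr_ge0 => k _; exact: term_ge0.
by rewrite mulr_gt0 ?exprn_gt0 ?normr_gt0 // ltcR.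
Qed.

(** Equal products and a smaller sum make (z - x i)(z - x j) negative at
    z = y i and z = y j, so both lie strictly above the smaller of x i, x j. *)
Lemma strict_maj_pair n (x y : 'I_n -> R) i j : i != j ->
  (forall k, k = i \/ k = j) -> (forall k, 0 < x k) -> (forall k, 0 < y k) ->
  x i * x j = y i * y j -> y i + y j < x i + x j ->
  strict_maj (codom (fun k => ln (y k))) (codom (fun k => ln (x k))).
Proof.
move=> ij two x0 y0 eq_prod lt_sum.
have sum2 (f : 'I_n -> R) : \sum_k f k = f i + f j.
  rewrite (bigD1 i) //= (bigD1 j) 1?eq_sym //= big1 ?addr0 //.
  by move=> k /andP[ki kj]; case: (two k) => e; rewrite e eqxx in ki kj.
have n2 : n = 2.
  have : #|[set: 'I_n]| = #|[set i; j]|.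
    by apply: eq_card => k; rewrite !inE; case: (two k) => ->; rewrite eqxx ?orbT.
  by rewrite cardsT card_ord cards2 ij.
apply: strict_maj_subsets; first by rewrite n2.
  by rewrite !sum2 -!lnM ?posrE // eq_prod.
move=> I cI; have /cards1P[k ->] : #|I| == 1%N by lia.
have [l ltl] : exists l, x l < y k.
  apply: contrapT => ge_all.
  have yi l : y k <= x l by rewrite leNgt; apply/negP => ?; apply: ge_all; exists l.
  have := mulr_ge0 (_ : 0 <= x i - y k) (_ : 0 <= x j - y k).
  rewrite !subr_ge0 => /(_ (yi i) (yi j)).
  have yk := y0 k.
  have : (y k - y i) * (y k - y j) = 0.
    by case: (two k) => ->; rewrite subrr ?mul0r ?mulr0.
  have : y k * (y i + y j) < y k * (x i + x j) by rewrite ltr_pM2l.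
  nra.
exists [set l]; rewrite ?cards1 // !big_set1 ltr_ln ?posrE //.
Qed.

(** With q = |U i j|^2 > 0, the trace of A^-1 U B U^* is smaller than that of
    A^-1 B by q (1/a j - 1/a i)(b j - b i), while the determinant is the same. *)
Lemma crossing_improvable n (a b : 'I_n -> R) i j : (forall k, 0 < a k) ->
  (forall k, 0 < b k) -> (forall k, k = i \/ k = j) -> a j < a i -> b i < b j ->
  improvable (rdiag a) (rdiag b).
Proof.
move=> a0 b0 two aji bij; have ij : i != j by apply: contraTN aji => /eqP->; rewrite ltxx.
have sum2 (V : nmodType) (f : 'I_n -> V) : \sum_k f k = f i + f j.
  rewrite (bigD1 i) //= (bigD1 j) 1?eq_sym //= big1 ?addr0 //.
  by move=> k /andP[ki kj]; case: (two k) => e; rewrite e eqxx in ki kj.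
have prod2 (f : 'I_n -> R) : \prod_k f k = f i * f j.
  rewrite (bigD1 i) //= (bigD1 j) 1?eq_sym //= big1 ?mulr1 //.
  by move=> k /andP[ki kj]; case: (two k) => e; rewrite e eqxx in ki kj.
pose X : 'M[C]_n := delta_mx j i - delta_mx i j.
have Xsk : X^t* = - X.
  by rewrite adjD adjN !trmx_delta !map_delta_mx opprB.
exists X => //; exists 1 => [|t /andP[t0 _]]; first exact: ltr01.
cbv zeta; have tXsk := skewZ t Xsk.
have [UU sU] := cayley_unitary tXsk.
have mulU := mul_cayley (skew_unit tXsk).
move: (cayley _) UU sU mulU => U UU sU mulU.
pose p k l := Normc.normc (U k l) ^+ 2.
have prow k : p k i + p k j = 1 by rewrite -(unitary_row_sum k UU) sum2.
have pcol l : p i l + p j l = 1.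
  have := unitary_row_sum (U := U^t* ) l; rewrite trmxCK => /(_ sU); rewrite sum2.
  by rewrite !adjE !normc_conj.
have pij : 0 < p i j.
  rewrite exprn_even_gt0 //=; apply/eqP => /Normc.eq0_normc/eqP.
  apply/negP; apply: cayley_plane_neq0 ij _ mulU.
  by apply: contraTneq t0 => /complexI->; rewrite ltxx.
have Apd := posdef_rdiag_gt0 a0; have Bpd := posdef_rdiag_gt0 b0.
have B'pd : posdefmx (U *m rdiag b *m U^t* ).
  have := posdefmx_congr (P := U^t* ) UU Bpd; by rewrite trmxCK.
have [V [y [VA VB y0]]] := simultaneous_diag Apd B'pd.
pose x k := (a k)^-1 * b k.
have sx : real_spectrum (invmx (rdiag a) *m rdiag b) (codom x).
  by rewrite invmx_rdiag // mul_rdiag; exact: real_spectrum_rdiag.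
have sy := real_spectrum_pencil (posdef_unit Apd) VA VB.
exists (codom x), (codom y); split; [exact: sx | exact: sy |].
have VV : V *m V^t* = rdiag (fun k => (a k)^-1).
  rewrite -invmx_rdiag //; have E : V *m V^t* *m rdiag a = 1%:M.
    by rewrite -mulmxA; apply: mulmx1C.
  by rewrite -[LHS](mulmxK (posdef_unit Apd)) E mul1mx.
rewrite !codom_ln; apply: (strict_maj_pair ij two) => //.
- by move=> k; rewrite mulr_gt0 ?invr_gt0.
- have : \det (rdiag y) = \det (rdiag x).
    have -> : rdiag x = V *m V^t* *m rdiag b by rewrite VV mul_rdiag.
    by rewrite -VB; exact: det_rotated_congr.
  rewrite !det_rdiag => /complexI; rewrite (prod2 y) (prod2 x) => ->.
  by [].
have ysum : \sum_k y k = \sum_k (a k)^-1 * \sum_l p k l * b l.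
  apply: complexI; rewrite -trace_rdiag -VB mxtrace_mulC.
  have -> : V *m (V^t* *m (U *m rdiag b *m U^t* )) =
      rdiag (fun k => (a k)^-1) *m (U *m rdiag b *m U^t* ).
    by rewrite -VV mulmxA.
  rewrite trace_rdiag_mul.
  rewrite rmorph_sum; apply: eq_bigr => k _; rewrite unitary_diag_entry rmorphM.
  by [].
rewrite sum2 in ysum; rewrite ysum !sum2.
have ab : 0 < ((a j)^-1 - (a i)^-1) * (b j - b i).
  by rewrite mulr_gt0 ?subr_gt0 // ltf_pV2 ?posrE.
have := mulr_gt0 pij ab.
rewrite /x; have := prow i; have := prow j; have := pcol i.
move: (p i i) (p i j) (p j i) (p j j) => p1 p2 p3 p4 e1 e2 e3.
have -> : p1 = 1 - p2 by lra.
have -> : p3 = p2 by lra.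
have -> : p4 = 1 - p2 by lra.
lra.
Qed.

Lemma herm_offdiag0 n (M : 'M[C]_n) : M^t* = M -> (forall i j, i != j -> M i j = 0) ->
  exists a : 'I_n -> R, M = rdiag a.
Proof.
move=> Mh M0; exists (fun i => complex.Re (M i i)); apply/matrixP => i j.
rewrite rdiagE; case: (eqVneq i j) => [<-|/M0->]; last by rewrite mulr0n.
rewrite mulr1n; apply/esym/RRe_real/CrealP.
by have /matrixP/(_ i i) := Mh; rewrite adjE.
Qed.

(** In a common orthonormal eigenbasis either some pair of indices is ordered
    oppositely by A and B, and [crossing_improvable] applies to the plane they
    span, or all pairs are ordered consistently. *)
Lemma commuting_cases n (A B : 'M[C]_n) : posdefmx A -> posdefmx B ->
  A *m B = B *m A -> improvable A B \/
  exists P, exists a b : 'I_n -> R, [/\ P *m P^t* = 1%:M, P^t* *m P = 1%:M,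
    P *m A *m P^t* = rdiag a, P *m B *m P^t* = rdiag b &
    [/\ forall i, 0 < a i, forall i, 0 < b i &
        forall i j, a j < a i -> b j <= b i]].
Proof.
move=> Apd Bpd comm; have [/hermP Ah _] := Apd; have [/hermP Bh _] := Bpd.
have [P [PP sP A0 B0]] := comm_hermitian_diag Ah Bh comm.
have A'pd : posdefmx (P *m A *m P^t* ).
  have := posdefmx_congr (P := P^t* ) PP Apd; by rewrite trmxCK.
have B'pd : posdefmx (P *m B *m P^t* ).
  have := posdefmx_congr (P := P^t* ) PP Bpd; by rewrite trmxCK.
have [/hermP A'h _] := A'pd; have [/hermP B'h _] := B'pd.
have [a Aa] := herm_offdiag0 A'h A0; have [b Bb] := herm_offdiag0 B'h B0.
rewrite Aa in A'pd; rewrite Bb in B'pd.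
have a0 := posdef_rdiag A'pd; have b0 := posdef_rdiag B'pd.
have [[i [j [aji bij]]]|aligned] := EM (exists i j, a j < a i /\ b i < b j); last first.
  right; exists P, a, b; split=> //; split=> // i j aji; rewrite leNgt.
  by apply/negP => bij; apply: aligned; exists i, j.
left; apply: (improvable_unitary PP sP (posdef_unit Apd)); rewrite Aa Bb.
pose S := [set i; j]; have iS : i \in S by rewrite !inE eqxx.
have jS : j \in S by rewrite !inE eqxx orbT.
have dec (f : 'I_n -> R) : decoupled S (rdiag f).
  move=> k l kl; rewrite rdiagE; case: (eqVneq k l) => [e|_ //].
  by rewrite e eqxx in kl.
have restrE (f : 'I_n -> R) : restr S (rdiag f) = rdiag (fun k => f (enum_val k)).
  by apply/matrixP => k l; rewrite rdiagE mxE rdiagE (inj_eq enum_val_inj).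
apply: (improvable_restr A'pd B'pd (dec a) (dec b)); rewrite !restrE.
apply: (@crossing_improvable _ _ _ (enum_rank_in iS i) (enum_rank_in iS j)).
- by move=> k; exact: a0.
- by move=> k; exact: b0.
- move=> k; have := enum_valP k; rewrite !inE => /orP[]/eqP ek.
    by left; apply: enum_val_inj; rewrite enum_rankK_in.
  by right; apply: enum_val_inj; rewrite enum_rankK_in.
- by rewrite !enum_rankK_in.
- by rewrite !enum_rankK_in.
Qed.

End Commuting.

(** * Ordered logarithms of spectra *)

Section LogSpectra.
Context {R : realType}.
Local Notation C := R[i].

Let ge_total' : total (>=%R : rel R). Proof. by move=> a b; exact: ge_total. Qed.
Let ge_trans' : transitive (>=%R : rel R).
Proof. by move=> a b c ba ac; exact: le_trans ac ba. Qed.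
Let ge_anti' : antisymmetric (>=%R : rel R).
Proof. by move=> a b; rewrite andbC => /le_anti. Qed.

Lemma perm_sort_ge (s u : seq R) : perm_eq s u -> sort >=%R s = sort >=%R u.
Proof. by move/perm_sortP; apply. Qed.

Lemma sort_ge_uniq (s u : seq R) : perm_eq s u -> sorted >=%R u -> sort >=%R s = u.
Proof.
move=> su u_sorted; apply: (sorted_eq ge_trans' ge_anti') => //.
  exact: sort_sorted.
by rewrite perm_sort.
Qed.

Lemma row_entries d (r : seq R) (f : R -> R) : size r = d ->
  [seq (\row_(i < d) f r`_i) 0 j | j <- enum 'I_d] = map f r.
Proof.
move=> szr; apply: (@eq_from_nth _ 0) => [|j]; rewrite size_map size_enum_ord.
  by rewrite size_map szr.
move=> jd; rewrite (nth_map (Ordinal jd)) ?size_enum_ord // (nth_map 0) ?szr // mxE.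
by rewrite nth_enum_ord.
Qed.

Lemma log_eigvals_entries d (M : 'M[C]_d) s : real_spectrum M s ->
  [seq logv (eigvals M) 0 j | j <- enum 'I_d] = map (@ln R) (sort >=%R s).
Proof.
move=> Ms; have sz := real_spectrum_size Ms.
have -> : logv (eigvals M) = \row_(i < d) ln (sort >=%R s)`_i.
  by rewrite (eigvalsE Ms); apply/rowP => i; rewrite !mxE.
by apply: row_entries; rewrite size_sort.
Qed.

Lemma dec_rearr_logE d (M : 'M[C]_d) s i : real_spectrum M s ->
  dec_rearr (logv (eigvals M)) 0 i = (sort >=%R (map (@ln R) s))`_i.
Proof.
move=> Ms; rewrite mxE; congr (nth _ _ _); rewrite (log_eigvals_entries Ms).
by apply: perm_sort_ge; apply: perm_map; rewrite perm_sort.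
Qed.

Lemma log_majorized d (M M' : 'M[C]_d) s s' :
  real_spectrum M s -> real_spectrum M' s' ->
  strict_maj (map (@ln R) s') (map (@ln R) s) ->
  logv (eigvals M) <> logv (eigvals M') /\
  majorized (logv (eigvals M')) (logv (eigvals M)).
Proof.
move=> Ms Ms' maj; have sz := real_spectrum_size Ms; have sz' := real_spectrum_size Ms'.
have permL N u : real_spectrum N u ->
    perm_eq [seq logv (eigvals N) 0 j | j <- enum 'I_d] (map (@ln R) u).
  by move=> Nu; rewrite (log_eigvals_entries Nu); apply: perm_map; rewrite perm_sort.
split.
  move=> E; have /negP := strict_maj_neq maj; apply.
  rewrite perm_sym; apply: perm_trans (permL _ _ Ms'); rewrite -E.
  by rewrite perm_sym; exact: permL.
split=> [j /andP[j0 jd]|].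
  have top N u : real_spectrum N u ->
      \sum_(i < d | (i < j)%N) dec_rearr (logv (eigvals N)) 0 i =
      \sum_(0 <= i < j) (sort >=%R (map (@ln R) u))`_i.
    move=> Nu; rewrite big_mkord.
    rewrite (big_ord_widen _ (fun i => (sort >=%R (map (@ln R) u))`_i) jd).
    by apply: eq_bigr => i _; rewrite (dec_rearr_logE _ Nu).
  have eq_le (x y x' y' : R) : x = x' -> y = y' -> x' <= y' -> x <= y by move=> -> ->.
  apply: (eq_le _ _ _ _ (top _ _ Ms') (top _ _ Ms)); apply: topsum_le maj _ _.
    by rewrite !size_map sz sz'.
  by rewrite size_map sz j0.
have sumL N u : real_spectrum N u ->
    \sum_(i < d) logv (eigvals N) 0 i = \sum_(x <- map (@ln R) u) x.
  by move=> Nu; rewrite -(perm_big _ (permL _ _ Nu)) big_map big_enum.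
apply: etrans (sumL _ _ Ms') (etrans _ (esym (sumL _ _ Ms))).
by case: maj.
Qed.

(** Sorting the indices by a, ties broken by b, sorts both sequences, so the
    ordered logarithms of the spectra are subtracted index by index. *)
Lemma aligned_log_spectra d (A B P : 'M[C]_d) (a b : 'I_d -> R) :
  P *m P^t* = 1%:M -> P^t* *m P = 1%:M -> A \in unitmx ->
  P *m A *m P^t* = rdiag a -> P *m B *m P^t* = rdiag b ->
  (forall i, 0 < a i) -> (forall i, 0 < b i) ->
  (forall i j, a j < a i -> b j <= b i) ->
  logv (eigvals (invmx A *m B)) =
  dec_rearr (logv (eigvals B) - logv (eigvals A)).
Proof.
move=> PP sP Au PA PB a0 b0 aligned.
have As : real_spectrum A (codom a).
  by apply: (real_spectrum_unitary PP sP); rewrite PA; exact: real_spectrum_rdiag.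
have Bs : real_spectrum B (codom b).
  by apply: (real_spectrum_unitary PP sP); rewrite PB; exact: real_spectrum_rdiag.
pose x i := (a i)^-1 * b i; have x0 i : 0 < x i by rewrite mulr_gt0 ?invr_gt0.
have Xs : real_spectrum (invmx A *m B) (codom x).
  apply: (real_spectrum_unitary PP sP); rewrite -(invmx_mul_conj _ PP Au) PA PB.
  by rewrite invmx_rdiag // mul_rdiag; exact: real_spectrum_rdiag.
(* one ordering of the indices that sorts a and b simultaneously *)
pose r i j := (a j < a i) || (a i == a j) && (b j <= b i).
have r_total : total r.
  move=> i j; rewrite /r; case: (ltgtP (a i) (a j)) => //= e.
  exact: le_total.
pose l := sort r (enum 'I_d); have l_sorted : sorted r l by exact: sort_sorted.
have l_perm : perm_eq l (enum 'I_d) by rewrite perm_sort.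
have szl : size l = d by rewrite size_sort size_enum_ord.
have sortl (f : 'I_d -> R) : (forall i j, r i j -> f j <= f i) ->
    sort >=%R (codom f) = map f l.
  move=> fr; apply: sort_ge_uniq; first by rewrite perm_sym; exact: perm_map.
  by rewrite sorted_map; apply: sub_sorted l_sorted => i j; exact: fr.
have sa : sort >=%R (codom a) = map a l.
  by apply: sortl => i j /orP[/ltW//|/andP[/eqP-> _]].
have sb : sort >=%R (codom b) = map b l.
  by apply: sortl => i j /orP[/aligned//|/andP[]].
apply/rowP => i; rewrite [LHS]mxE (eigvalsE Xs) [in LHS]mxE [RHS]mxE.
have diffE : [seq (logv (eigvals B) - logv (eigvals A)) 0 j | j <- enum 'I_d] =
    map (fun k => ln (x k)) l.
  have -> : logv (eigvals B) - logv (eigvals A) =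
      \row_(j < d) idfun (map (fun k => ln (x k)) l)`_j.
    apply/rowP => j; rewrite (eigvalsE As) (eigvalsE Bs) sa sb !mxE.
    by rewrite !(nth_map j) ?szl // /x mulrC ln_div ?posrE.
  by rewrite row_entries ?size_map ?map_id.
rewrite diffE -(@nth_map _ 0 _ 0 (@ln R)); last by rewrite size_sort size_codom card_ord.
congr (nth _ _ _); apply/esym/sort_ge_uniq.
  rewrite map_comp; apply: perm_map; rewrite perm_sym perm_sort perm_sym.
  exact: perm_map.
rewrite sorted_map.
have := sort_sorted ge_total' (codom x).
have: all (fun z => 0 < z) (sort >=%R (codom x)).
  by rewrite all_sort; apply/allP => z /codomP[k ->].
move=> pos; apply: (sub_in_sorted _ pos) => z w z0 w0 /=.
by rewrite ler_ln ?posrE.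
Qed.

End LogSpectra.

(** * Continuity of the curve and conclusion *)

From mathcomp Require Import all_classical all_reals all_analysis.

Import numFieldNormedType.Exports.

Local Open Scope classical_set_scope.
Local Open Scope ring_scope.
Local Open Scope sesquilinear_scope.
Local Open Scope complex_scope.

Section Continuity.
Context {R : realType}.
Local Notation C := R[i].

Lemma euclidean_norm_ge0 d (v : 'cV[C]_d) : 0 <= euclidean_norm v.
Proof. exact: sqrtr_ge0. Qed.

Lemma sqr_normc (z : C) :
  complex.Re z ^+ 2 + complex.Im z ^+ 2 = Normc.normc z ^+ 2.
Proof. by case: z => a b /=; rewrite sqr_sqrtr ?addr_ge0 ?sqr_ge0. Qed.

Lemma euclidean_norm_le_sum d (v : 'cV[C]_d) :
  euclidean_norm v <= \sum_i Normc.normc (v i 0).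
Proof.
have S0 : 0 <= \sum_i Normc.normc (v i 0) by apply: sumr_ge0 => i _; exact: normc_ge0.
rewrite -[leRHS]ger0_norm // -sqrtr_sqr ler_wsqrtr //.
under eq_bigr do rewrite sqr_normc.
rewrite expr2 mulr_suml; apply: ler_sum => i _; rewrite expr2.
apply: ler_wpM2l; first exact: normc_ge0.
by rewrite (bigD1 i) //= lerDl; apply: sumr_ge0 => j _; exact: normc_ge0.
Qed.

Lemma entry_le_euclidean_norm d (v : 'cV[C]_d) i :
  Normc.normc (v i 0) <= euclidean_norm v.
Proof.
rewrite -[leLHS]ger0_norm ?normc_ge0 // -sqrtr_sqr ler_wsqrtr // -sqr_normc.
rewrite [leRHS](bigD1 i) //= lerDl; apply: sumr_ge0 => j _.
by rewrite addr_ge0 ?sqr_ge0.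
Qed.

(** A unit vector has entries of modulus at most 1, so the norm of its image is
    at most the sum of the moduli of the entries of M. The supremum over the
    empty set, for d = 0, is 0. *)
Lemma spectral_norm_bounds d (M : 'M[C]_d) : 0 <= spectral_norm M <= mnorm M.
Proof.
rewrite /spectral_norm; set E := [set euclidean_norm _ | v in _].
have Eub : ubound E (mnorm M).
  move=> _ [v /= v1 <-]; apply: le_trans (euclidean_norm_le_sum _) _.
  apply: ler_sum => i _; rewrite mxE; apply: le_trans (normc_sum _) _.
  apply: ler_sum => j _; rewrite Normc.normcM ler_piMr ?normc_ge0 //.
  by rewrite -v1 entry_le_euclidean_norm.
have [E0|/set0P[x Ex]] := eqVneq E set0; first by rewrite E0 sup0 lexx mnorm_ge0.
apply/andP; split; last by apply: ge_sup => //; exists x.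
apply: le_trans (ub_le_sup (ex_intro _ _ Eub) Ex).
by case: Ex => v _ <-; exact: euclidean_norm_ge0.
Qed.

(** [cayley_diff] with bounded outer factors. *)
Lemma cayley_lipschitz d (X : 'M[C]_d) : X^t* = - X -> exists L : R, forall s t : R,
  mnorm (cayley (t%:C *: X) - cayley (s%:C *: X)) <= L * `|t - s|.
Proof.
move=> Xsk; have [c cayley_le] : exists c : R, forall K : 'M[C]_d, K^t* = - K ->
    mnorm (1%:M + cayley K) <= c by exists (2 * d%:R ^+ 2) => K; exact: mnorm_1cayley.
exists (c * mnorm X * c) => s t.
have tsk := skewZ t Xsk; have ssk := skewZ s Xsk.
have := cayley_diff (skew_unit tsk) (skew_unit ssk).
rewrite -scalerBl -rmorphB /= => E.
have le2 (M : 'M[C]_d) : mnorm M <= mnorm (2 *: M).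
  have := mnormZ (2 : R)%:C M; rewrite normc_real ger0_norm // rmorph_nat => ->.
  by rewrite ler_peMl ?mnorm_ge0 // ler1n.
apply: le_trans (le2 _) _; rewrite {}E.
apply: le_trans (mnormM _ _) _; rewrite mulrAC.
apply: ler_pM; rewrite ?mnorm_ge0 ?cayley_le //.
apply: le_trans (mnormM _ _) _; rewrite -mulrA.
apply: ler_pM; rewrite ?mnorm_ge0 ?cayley_le //.
by rewrite mnormZ normc_real mulrC.
Qed.

Lemma cayley_curve_continuous d (X : 'M[C]_d) (a b : R) : X^t* = - X ->
  continuous_curve a b (fun t => cayley (`|t|%:C *: X)).
Proof.
move=> Xsk s _; have [L lipL] := cayley_lipschitz Xsk.
apply/cvgr0Pnorm_lt => e e0; pose r := e / (`|L| + 1).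
have L1 : 0 < `|L| + 1 by rewrite ltr_wpDl.
have r0 : 0 < r by rewrite divr_gt0.
apply/nbhs_ballP; exists r => //= t; rewrite /ball /= distrC => ts.
have /andP[sn0 snM] :=
  spectral_norm_bounds (cayley (`|t|%:C *: X) - cayley (`|s|%:C *: X)).
rewrite ger0_norm //; apply: le_lt_trans snM _; apply: le_lt_trans (lipL _ _) _.
apply: (@le_lt_trans _ _ ((`|L| + 1) * `|t - s|)).
  apply: (@le_trans _ _ (`|L| * `| `|t| - `|s| |)).
    by rewrite ler_wpM2r // ler_norm.
  apply: ler_pM => //; first by rewrite lerDl.
  exact: ler_dist_dist.
by rewrite mulrC -ltr_pdivlMr.
Qed.

End Continuity.

Theorem theorem3p5 (R : realType) (d : nat) (A B : 'M[R[i]]_d)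
  (hA : posdefmx A) (hB : posdefmx B)
  (hAB : logv (eigvals (invmx A *m B)) <>
         dec_rearr (logv (eigvals B) - logv (eigvals A))) :
  exists2 t0 : R, 0 < t0 &
  exists gamma : R -> 'M[R[i]]_d,
    [/\ forall t, - t0 < t < t0 -> gamma t \is unitarymx,
        continuous_curve (- t0) t0 gamma,
        gamma 0 = 1%:M &
        forall t, - t0 < t < t0 -> t <> 0 ->
          logv (eigvals (invmx A *m B)) <>
            logv (eigvals (invmx A *m gamma t *m B *m (gamma t)^t*)) /\
          majorized
            (logv (eigvals (invmx A *m gamma t *m B *m (gamma t)^t*)))
            (logv (eigvals (invmx A *m B)))].
Proof.
have [X Xsk [t0 t0_gt0 imp]] : improvable A B.
  have [comm|ncomm] := EM (A *m B = B *m A); last exact: noncommuting_improvable.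
  have [//|[P [a [b [PP sP PA PB [a0 b0 aligned]]]]]] := commuting_cases hA hB comm.
  case: hAB; exact: aligned_log_spectra PP sP (posdef_unit hA) PA PB a0 b0 aligned.
(* The majorization holds for positive parameters; the absolute value extends
   it to both sides of 0. *)
exists t0 => //; exists (fun t => cayley (`|t|%:C *: X)); split.
- by move=> t _; apply/unitarymxP; have [] := cayley_unitary (skewZ `|t| Xsk).
- exact: cayley_curve_continuous.
- by rewrite normr0 scale0r cayley0.
move=> t tt0 /eqP t_neq0.
have [|s [s' [sp sp' maj]]] := imp `|t|; first by rewrite normr_gt0 t_neq0 ltr_norml.
move: (cayley _) sp' => U sp'.
have -> : invmx A *m U *m B *m U^t* = invmx A *m (U *m B *m U^t* ).
  by rewrite (mulmxA _ _ (U^t* )) (mulmxA _ U B).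
exact: log_majorized sp sp' maj.
Qed.
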